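(* Let $T$ be a (finite) rooted tree with vertex set $S$, regarded as a poset via its tree order. Then $$\Gamma_T\cong \lim_T P = \left\{(\gamma_s)_{s\in S}\in\prod_{s\in S}P(s)\ \middle|\ \rho_{s's}(\gamma_s)=\gamma_{s'}\ \text{ for all } s'\le s\right\}.$$
   Context: Let $T$ be a finite rooted tree with vertex set $S$ and root $r$. For $s\in S$, $T_s$ denotes the linear tree (path) joining $s$ to $r$, identified with its set of vertices (including $s$ and $r$). The partial order on $S$ is: $s\le t$ iff $T_s\subseteq T_t$. The comparability graph $G_T$ has vertex set $S$, with $\{s,t\}$ an edge iff $s\ne t$ and $s,t$ are comparable for $\le$. For a graph $G=(V,E)$, $X(G)=\{(x_v)_{v\in V}\in\mathbb{C}^V : x_i\ne x_j \text{ for all } \{i,j\}\in E\}$ and $\Gamma(G)=\pi_1(X(G))$. Set $\Gamma_T=\Gamma(G_T)$; equivalently, $\Gamma_T$ is the fundamental group of the complement of the arrangement associated to $T$. For a finite set $I$, $C_I$ is the complete graph on $I$ and $P(I)=\pi_1(X(C_I))$ (the colored, i.e. pure, braid group on $|I|$ strands). For $s\in S$ set $P(s)=P(T_s)$. For $s'\le s$, $\rho_{s's}:P(s)\to P(s')$ is the homomorphism induced on $\pi_1$ by the coordinate projection $X(C_{T_s})\to X(C_{T_{s'}})$; thus $P$ is a contravariant functor on the poset $T$. Spaces are pointed and maps preserve base points: fix a base point of $\mathbb{C}^S$ with pairwise distinct coordinates, and use it and its coordinate projections as base points of all the spaces involved. *)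

(* Defs.v *)
From HB Require Import structures.
From mathcomp Require Import all_boot all_order all_algebra.
From mathcomp Require Import generic_quotient monoid.
From mathcomp Require Import complex lra.
From mathcomp Require Import all_classical all_reals topology normedtype.
From mathcomp Require Import homotopy.

Set Implicit Arguments.
Unset Strict Implicit.
Unset Printing Implicit Defensive.

Import Order.TTheory GRing.Theory Num.Theory.
Import numFieldNormedType.Exports.

Local Open Scope classical_set_scope.
Local Open Scope ring_scope.
Local Open Scope quotient_scope.
Local Open Scope complex_scope.

Definition unit_interval (R : realType) : Type := set_type (`[0, 1]%classic : set R).

HB.instance Definition _ (R : realType) := Topological.on (unit_interval R).

Lemma comp_continuous (Z Y W : topologicalType) (g : Y -> W) (f : Z -> Y) :
  continuous f -> continuous g -> continuous (fun z => g (f z)).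
Proof.
by move=> cf cg z; apply: (@continuous_comp _ _ _ f g); [exact: cf|exact: cg].
Qed.

Lemma pair_continuous (Z Y W : topologicalType) (f : Z -> Y) (g : Z -> W) :
  continuous f -> continuous g -> continuous (fun z => (f z, g z)).
Proof. by move=> cf cg z; apply: cvg_pair; [exact: cf|exact: cg]. Qed.

Lemma fst_continuous (Z Y : topologicalType) :
  continuous (fun z : Z * Y => z.1).
Proof. by move=> z; exact: cvg_fst. Qed.

Lemma snd_continuous (Z Y : topologicalType) :
  continuous (fun z : Z * Y => z.2).
Proof. by move=> z; exact: cvg_snd. Qed.

Lemma addr_continuous (R : realType) (Z : topologicalType) (f g : Z -> R) :
  continuous f -> continuous g -> continuous (fun z => f z + g z).
Proof. by move=> cf cg z; apply: cvgD; [exact: cf|exact: cg]. Qed.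

Lemma subr_continuous (R : realType) (Z : topologicalType) (f g : Z -> R) :
  continuous f -> continuous g -> continuous (fun z => f z - g z).
Proof. by move=> cf cg z; apply: cvgB; [exact: cf|exact: cg]. Qed.

Lemma mulr_continuous (R : realType) (Z : topologicalType) (f g : Z -> R) :
  continuous f -> continuous g -> continuous (fun z => f z * g z).
Proof. by move=> cf cg z; apply: cvgM; [exact: cf|exact: cg]. Qed.

Lemma min_continuous (R : realType) (Z : topologicalType) (f g : Z -> R) :
  continuous f -> continuous g -> continuous (fun z => Num.min (f z) (g z)).
Proof. by move=> cf cg z; exact: (continuous_min (cf z) (cg z)). Qed.

Lemma max_continuous (R : realType) (Z : topologicalType) (f g : Z -> R) :
  continuous f -> continuous g -> continuous (fun z => Num.max (f z) (g z)).
Proof. by move=> cf cg z; exact: (continuous_max (cf z) (cg z)). Qed.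

Section UnitInterval.
Variable R : realType.
Local Notation I := (unit_interval R).

Lemma clamp_in (t : R) : Num.min 1 (Num.max 0 t) \in (`[0, 1]%classic : set R).
Proof.
by rewrite inE /= in_itv /= le_min ler01 le_max lexx ge_min lexx.
Qed.

(* The nearest-point retraction of the line onto the unit interval. *)
Definition clamp (t : R) : I :=
  exist (fun t => t \in (`[0, 1]%classic : set R)) _ (clamp_in t).

Definition ival (t : I) : R := set_val t.

Lemma ival_ge0 t : 0 <= ival t.
Proof. by have := set_valP t; rewrite /= in_itv /= => /andP[]. Qed.

Lemma ival_le1 t : ival t <= 1.
Proof. by have := set_valP t; rewrite /= in_itv /= => /andP[]. Qed.

Lemma ival_inj : injective ival.
Proof. exact: val_inj. Qed.

Lemma clampE t : ival (clamp t) = Num.min 1 (Num.max 0 t).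
Proof. by rewrite /ival set_valE. Qed.

Lemma clampK t : clamp (ival t) = t.
Proof.
apply: ival_inj; rewrite clampE.
by rewrite (max_idPr (ival_ge0 t)) (min_idPr (ival_le1 t)).
Qed.

Lemma ival_clamp t : 0 <= t -> t <= 1 -> ival (clamp t) = t.
Proof. by move=> t0 t1; rewrite clampE (max_idPr t0) (min_idPr t1). Qed.

Fact interval_zero_one_neq : clamp 0 != clamp 1.
Proof.
apply/negP => /eqP /(congr1 ival); rewrite !ival_clamp ?lexx ?ler01 //.
by move/eqP; rewrite eq_sym oner_eq0.
Qed.

HB.instance Definition _ := isBiPointed.Build I interval_zero_one_neq.

Lemma ival0 : ival zero = 0. Proof. by rewrite ival_clamp ?lexx ?ler01. Qed.

Lemma ival1 : ival one = 1. Proof. by rewrite ival_clamp ?lexx ?ler01. Qed.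

Lemma ival_continuous : continuous ival.
Proof. exact: initial_continuous. Qed.

Lemma clamp_continuous : continuous clamp.
Proof.
apply: continuous_comp_initial.
change (continuous (fun t : R => Num.min 1 (Num.max 0 t))).
apply: min_continuous; first exact: cst_continuous.
by apply: max_continuous => [|t]; [exact: cst_continuous|exact: cvg_id].
Qed.

Lemma clamp_comp_continuous (Z : topologicalType) (f : Z -> R) :
  continuous f -> continuous (fun z => clamp (f z)).
Proof. by move=> cf; exact: (comp_continuous cf clamp_continuous). Qed.

Lemma ival_comp_continuous (Z : topologicalType) (f : Z -> I) :
  continuous f -> continuous (fun z => ival (f z)).
Proof. by move=> cf; exact: (comp_continuous cf ival_continuous). Qed.

End UnitInterval.

Ltac continuity :=
  lazymatch goal with
  | |- forall x, continuous_at x ?f =>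
    lazymatch f with
    | (fun z => clamp _) => apply: clamp_comp_continuous; continuity
    | (fun z => ival z) => exact: ival_continuous
    | (fun z => (_, _)) => apply: pair_continuous; continuity
    | (fun z => Num.min _ _) => apply: min_continuous; continuity
    | (fun z => Num.max _ _) => apply: max_continuous; continuity
    | (fun z => _ - _) => apply: subr_continuous; continuity
    | (fun z => _ + _) => apply: addr_continuous; continuity
    | (fun z => _ * _) => apply: mulr_continuous; continuity
    | _ => first [ exact: fst_continuous | exact: snd_continuous
                 | exact: ival_continuous
                 | apply: ival_comp_continuous; continuity
                 | exact: cst_continuous | idtac ]
    end
  end.

Section Gluing.
Variables (R : realType) (Z X : topologicalType) (h : Z -> R) (f g : Z -> X).
Variable c : R.

Lemma glue_continuous :
  continuous h -> continuous f -> continuous g ->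
  (forall z, h z = c -> f z = g z) ->
  continuous (fun z => if h z <= c then f z else g z).
Proof.
move=> ch cf cg fg z U /= Uz.
change (\forall w \near z, U (if h w <= c then f w else g w)).
case: (ltgtP (h z) c) Uz => [hlt|hgt|hc] Uz.
- have nh : \forall w \near z, h w < c by exact: (cvgr_lt _ (ch z)).
  have nf : \forall w \near z, U (f w) by exact: (cf z U).
  near=> w => /=.
  have -> : h w <= c by apply: ltW; near: w.
  by near: w.
- have nh : \forall w \near z, c < h w by exact: (cvgr_gt _ (ch z)).
  have nf : \forall w \near z, U (g w) by exact: (cg z U).
  near=> w => /=; rewrite leNgt.
  suff -> : c < h w by near: w.
  by near: w.
- have nf : \forall w \near z, U (f w) by exact: (cf z U).
  have ng : \forall w \near z, U (g w) by apply: (cg z U); rewrite /= -fg.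
  by near=> w => /=; case: ifP => _; near: w.
Unshelve. all: by end_near. Qed.

End Gluing.

Section PathHomotopy.
Variables (R : realType) (X : topologicalType).
Local Notation I := (unit_interval R).

Section FixedEnds.
Variables x y : X.
Implicit Types p q r : {path I from x to y in X}.

(* Homotopy relative to the end points; the second variable is the time. *)
Definition homotopic p q : Prop :=
  exists H : I * I -> X,
    [/\ continuous H,
        forall t, H (t, zero) = p t,
        forall t, H (t, one) = q t &
        forall s, H (zero, s) = x /\ H (one, s) = y].

Lemma homotopic_refl p : homotopic p p.
Proof.
exists (fun z => p z.1); split=> //= [|s]; last by rewrite path_zero path_one.
by apply: (comp_continuous (g := p)); [continuity|exact: cts_fun].
Qed.

Lemma homotopic_sym p q : homotopic p q -> homotopic q p.
Proof.
move=> [H [cH H0 H1 He]].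
exists (fun z => H (z.1, clamp (1 - ival z.2))); split=> [|t|t|s] /=.
- by apply: (comp_continuous (g := H)) => //; continuity.
- by rewrite ival0 subr0 -(H1 t).
- by rewrite ival1 subrr -(H0 t).
- exact: He.
Qed.

Lemma homotopic_trans q p r : homotopic p q -> homotopic q r -> homotopic p r.
Proof.
move=> [H [cH H0 H1 He]] [K [cK K0 K1 Ke]].
exists (fun z => if ival z.2 <= 2^-1 then H (z.1, clamp (2 * ival z.2))
                 else K (z.1, clamp (2 * ival z.2 - 1))).
split=> [|t|t|s] /=.
- apply: (@glue_continuous R _ _ (fun z : I * I => ival z.2)).
  + by continuity.
  + by apply: (comp_continuous (g := H)) => //; continuity.
  + by apply: (comp_continuous (g := K)) => //; continuity.
  + by move=> z ->; rewrite mulfV ?pnatr_eq0 // subrr H1 K0.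
- by rewrite ival0 invr_ge0 ler0n mulr0 H0.
- rewrite ival1 ifF; last by lra.
  by rewrite mulr1 (_ : 2 - 1 = 1) ?K1 //; lra.
- by case: ifP.
Qed.

Lemma homotopic_ext p q : p =1 q -> homotopic p q.
Proof. by move=> /path_eqP ->; exact: homotopic_refl. Qed.

End FixedEnds.

Lemma homotopic_reparam (a b x y : X) (p : {path I from a to b in X})
    (q1 q2 : {path I from x to y in X}) (f1 f2 : I -> R) :
  continuous f1 -> continuous f2 -> f1 zero = f2 zero -> f1 one = f2 one ->
  (forall t, q1 t = p (clamp (f1 t))) -> (forall t, q2 t = p (clamp (f2 t))) ->
  homotopic q1 q2.
Proof.
move=> c1 c2 e0 e1 q1E q2E.
exists (fun z => p (clamp ((1 - ival z.2) * f1 z.1 + ival z.2 * f2 z.1))).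
split=> [|t|t|s] /=.
- apply: (comp_continuous (g := p)); last exact: cts_fun.
  continuity; first exact: (comp_continuous (@fst_continuous _ _) c1).
  exact: (comp_continuous (@fst_continuous _ _) c2).
- by rewrite ival0 subr0 mul1r mul0r addr0 q1E.
- by rewrite ival1 subrr mul1r mul0r add0r q2E.
- rewrite -e0 -e1 -!mulrDl subrK !mul1r -!q1E.
  by rewrite path_zero path_one.
Qed.

Section Concat.
Variables x y z : X.
Variables (p : {path I from x to y in X}) (q : {path I from y to z in X}).

(* First p, then q, each at double speed. *)
Definition concat_fun (t : I) : X :=
  if ival t <= 2^-1 then p (clamp (2 * ival t)) else q (clamp (2 * ival t - 1)).

Fact concat_continuous : continuous concat_fun.
Proof.
apply: glue_continuous => [|||t ->]; first by continuity.
- by apply: (comp_continuous (g := p)); [continuity|exact: cts_fun].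
- by apply: (comp_continuous (g := q)); [continuity|exact: cts_fun].
- by rewrite mulfV ?pnatr_eq0 // subrr [LHS]path_one [RHS]path_zero.
Qed.

Fact concat_zero : concat_fun zero = x.
Proof. by rewrite /concat_fun ival0 invr_ge0 ler0n mulr0 [LHS]path_zero. Qed.

Fact concat_one : concat_fun one = z.
Proof.
rewrite /concat_fun ival1 ifF; last by lra.
by rewrite mulr1 (_ : 2 - 1 = 1); [rewrite [LHS]path_one|lra].
Qed.

Definition concat : {path I from x to z in X} :=
  mk_path concat_continuous concat_zero concat_one.

Lemma concatE (u : R) : 0 <= u -> u <= 1 ->
  concat (clamp u) = if u <= 2^-1 then p (clamp (2 * u))
                     else q (clamp (2 * u - 1)).
Proof. by move=> u0 u1; rewrite /= /mk_path /concat_fun ival_clamp. Qed.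

Lemma concatl (u : R) : 0 <= u -> u <= 2^-1 ->
  concat (clamp u) = p (clamp (2 * u)).
Proof. by move=> u0 u1; rewrite concatE ?u1 //; lra. Qed.

Lemma concatr (u : R) : 2^-1 < u -> u <= 1 ->
  concat (clamp u) = q (clamp (2 * u - 1)).
Proof. by move=> u0 u1; rewrite concatE ?ifF //; lra. Qed.

End Concat.

Section Reverse.
Variables (x y : X) (p : {path I from x to y in X}).

Fact reverse_continuous : continuous (fun t : I => p (clamp (1 - ival t))).
Proof.
by apply: (comp_continuous (g := p)); [continuity|exact: cts_fun].
Qed.

Fact reverse_zero : p (clamp (1 - ival zero)) = y.
Proof. by rewrite ival0 subr0 [LHS]path_one. Qed.

Fact reverse_one : p (clamp (1 - ival one)) = x.
Proof. by rewrite ival1 subrr [LHS]path_zero. Qed.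

Definition reverse : {path I from y to x in X} :=
  mk_path reverse_continuous reverse_zero reverse_one.

End Reverse.

Lemma reverseE (x y : X) (p : {path I from x to y in X}) t :
  reverse p t = p (clamp (1 - ival t)).
Proof. by []. Qed.

Definition constant_path (x : X) : {path I from x to x in X} := cst x.

Lemma homotopic_concat (x y z : X) (p p' : {path I from x to y in X})
    (q q' : {path I from y to z in X}) :
  homotopic p p' -> homotopic q q' -> homotopic (concat p q) (concat p' q').
Proof.
move=> [H [cH H0 H1 He]] [K [cK K0 K1 Ke]].
exists (fun w => if ival w.1 <= 2^-1 then H (clamp (2 * ival w.1), w.2)
                 else K (clamp (2 * ival w.1 - 1), w.2)).
split=> [|t|t|s] /=.
- apply: (@glue_continuous R _ _ (fun w : I * I => ival w.1)).
  + by continuity.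
  + by apply: (comp_continuous (g := H)) => //; continuity.
  + by apply: (comp_continuous (g := K)) => //; continuity.
  + move=> w ->; rewrite mulfV ?pnatr_eq0 // subrr.
    by rewrite (He w.2).2 (Ke w.2).1.
- by rewrite H0 K0.
- by rewrite H1 K1.
- split.
    by rewrite ival0 invr_ge0 ler0n mulr0 (He s).1.
  rewrite ival1 ifF; last by lra.
  by rewrite mulr1 (_ : 2 - 1 = 1); [rewrite (Ke s).2|lra].
Qed.

Lemma homotopic_reverse (x y : X) (p q : {path I from x to y in X}) :
  homotopic p q -> homotopic (reverse p) (reverse q).
Proof.
move=> [H [cH H0 H1 He]].
exists (fun w => H (clamp (1 - ival w.1), w.2)); split=> [|t|t|s] /=.
- by apply: (comp_continuous (g := H)) => //; continuity.
- by rewrite H0.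
- by rewrite H1.
- by rewrite ival0 ival1 subr0 subrr (He s).1 (He s).2.
Qed.

Lemma homotopic_concatA (w x y z : X) (p : {path I from w to x in X})
    (q : {path I from x to y in X}) (r : {path I from y to z in X}) :
  homotopic (concat p (concat q r)) (concat (concat p q) r).
Proof.
pose f (t : I) : R :=
  Num.min (Num.min (2 * ival t) (ival t + 4^-1)) (2^-1 * ival t + 2^-1).
apply: (@homotopic_reparam _ _ _ _ (concat p (concat q r)) _ _ (@ival R) f).
- exact: ival_continuous.
- by rewrite /f; continuity.
- rewrite /f ival0 mulr0 mulr0 !add0r (min_idPl _) ?(min_idPl _) //; lra.
- rewrite /f ival1 !mulr1 (min_idPr _); first by lra.
  by rewrite le_min; apply/andP; split; lra.
- by move=> t; rewrite clampK.
- move=> t; have t0 := ival_ge0 t; have t1 := ival_le1 t.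
  rewrite -[in LHS](clampK t) /f; move: (ival t) t0 t1 => {f}u u0 u1.
  case: (leP u 4^-1) => [u4|u4]; [|case: (leP u 2^-1) => u2].
  + have -> : Num.min (2 * u) (u + 4^-1) = 2 * u by apply/min_idPl; lra.
    have -> : Num.min (2 * u) (2^-1 * u + 2^-1) = 2 * u.
      by apply/min_idPl; lra.
    by rewrite !concatl //; lra.
  + have -> : Num.min (2 * u) (u + 4^-1) = u + 4^-1 by apply/min_idPr; lra.
    have -> : Num.min (u + 4^-1) (2^-1 * u + 2^-1) = u + 4^-1.
      by apply/min_idPl; lra.
    rewrite concatl // (concatr p q); [|lra|lra].
    rewrite (concatr p); [|lra|lra].
    rewrite concatl; [|lra|lra].
    by congr (q (clamp _)); lra.
  + have -> : Num.min (Num.min (2 * u) (u + 4^-1)) (2^-1 * u + 2^-1) =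
              2^-1 * u + 2^-1.
      by apply/min_idPr; rewrite le_min; apply/andP; split; lra.
    rewrite concatr // (concatr p); [|lra|lra].
    rewrite concatr; [|lra|lra].
    by congr (r (clamp _)); lra.
Qed.

Lemma homotopic_concat_cstl (x y : X) (p : {path I from x to y in X}) :
  homotopic (concat (constant_path x) p) p.
Proof.
pose f (t : I) : R := Num.max 0 (2 * ival t - 1).
apply: (@homotopic_reparam _ _ _ _ p _ _ f (@ival R)).
- by rewrite /f; continuity.
- exact: ival_continuous.
- by rewrite /f ival0 mulr0 add0r (max_idPl _) //; lra.
- by rewrite /f ival1 mulr1 (max_idPr _); lra.
- move=> t; have t0 := ival_ge0 t; have t1 := ival_le1 t.
  rewrite -[in LHS](clampK t) /f; move: (ival t) t0 t1 => {f}u u0 u1.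
  rewrite concatE //; case: (leP u 2^-1) => u2.
    by rewrite (max_idPl _) ?[RHS]path_zero //; lra.
  by rewrite (max_idPr _) //; lra.
- by move=> t; rewrite clampK.
Qed.

Lemma homotopic_concat_cstr (x y : X) (p : {path I from x to y in X}) :
  homotopic (concat p (constant_path y)) p.
Proof.
pose f (t : I) : R := Num.min 1 (2 * ival t).
apply: (@homotopic_reparam _ _ _ _ p _ _ f (@ival R)).
- by rewrite /f; continuity.
- exact: ival_continuous.
- by rewrite /f ival0 mulr0 (min_idPr _) //; lra.
- by rewrite /f ival1 mulr1 (min_idPl _) //; lra.
- move=> t; have t0 := ival_ge0 t; have t1 := ival_le1 t.
  rewrite -[in LHS](clampK t) /f; move: (ival t) t0 t1 => {f}u u0 u1.
  rewrite concatE //; case: (leP u 2^-1) => u2.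
    by rewrite (min_idPr _) //; lra.
  by rewrite (min_idPl _) ?[RHS]path_one //; lra.
- by move=> t; rewrite clampK.
Qed.

Lemma homotopic_concat_reverser (x y : X) (p : {path I from x to y in X}) :
  homotopic (concat p (reverse p)) (constant_path x).
Proof.
pose f (t : I) : R := Num.min (2 * ival t) (2 - 2 * ival t).
apply: (@homotopic_reparam _ _ _ _ p _ _ f (fun=> 0)).
- by rewrite /f; continuity.
- exact: cst_continuous.
- by rewrite /f ival0 mulr0 (min_idPl _) //; lra.
- by rewrite /f ival1 mulr1 (min_idPr _) ?subrr //; lra.
- move=> t; have t0 := ival_ge0 t; have t1 := ival_le1 t.
  rewrite -[in LHS](clampK t) /f; move: (ival t) t0 t1 => {f}u u0 u1.
  rewrite concatE //; case: (leP u 2^-1) => u2.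
    by rewrite (min_idPl _) //; lra.
  rewrite reverseE ival_clamp; [|lra|lra].
  by rewrite (min_idPr _); [congr (p (clamp _)); lra|lra].
- by move=> t; rewrite [RHS]path_zero.
Qed.

Lemma reverseK (x y : X) (p : {path I from x to y in X}) :
  reverse (reverse p) = p.
Proof.
apply/path_eqP => t; rewrite !reverseE ival_clamp.
- by rewrite opprB addrC subrK clampK.
- by rewrite subr_ge0 ival_le1.
- by have := ival_ge0 t; lra.
Qed.

Lemma homotopic_concat_reversel (x y : X) (p : {path I from x to y in X}) :
  homotopic (concat (reverse p) p) (constant_path y).
Proof.
by rewrite -{2}[p]reverseK; exact: homotopic_concat_reverser.
Qed.

End PathHomotopy.

Section FundamentalGroup.
Variables (R : realType) (X : topologicalType) (x0 : X).
Local Notation I := (unit_interval R).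
Local Notation loop := {path I from x0 to x0 in X}.

Definition homotopicb (p q : loop) : bool := `[< homotopic p q >].

Lemma homotopicb_refl : reflexive homotopicb.
Proof. by move=> p; apply/asboolP; exact: homotopic_refl. Qed.

Lemma homotopicb_sym : symmetric homotopicb.
Proof. by move=> p q; apply/asboolP/asboolP; exact: homotopic_sym. Qed.

Lemma homotopicb_trans : transitive homotopicb.
Proof.
move=> q p r /asboolP pq /asboolP qr.
by apply/asboolP; exact: homotopic_trans pq qr.
Qed.

Canonical homotopic_equiv :=
  EquivRel homotopicb homotopicb_refl homotopicb_sym homotopicb_trans.

Definition pi1 : Type := {eq_quot homotopic_equiv}.

HB.instance Definition _ := Choice.on pi1.
HB.instance Definition _ := EqQuotient.on pi1.

Definition pi1_class (p : loop) : pi1 := \pi_pi1 p.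

Lemma pi1_classP p q : pi1_class p = pi1_class q <-> homotopic p q.
Proof. by split => [/eqmodP/asboolP|/asboolP h]; last exact/eqmodP. Qed.

Lemma pi1_repr a : pi1_class (repr a) = a.
Proof. exact: reprK. Qed.

Lemma homotopic_repr p : homotopic (repr (pi1_class p)) p.
Proof. by apply/pi1_classP; exact: pi1_repr. Qed.

Definition pi1_one : pi1 := pi1_class (constant_path R x0).

Definition pi1_mul (a b : pi1) : pi1 := pi1_class (concat (repr a) (repr b)).

Definition pi1_inv (a : pi1) : pi1 := pi1_class (reverse (repr a)).

Lemma pi1_mulE p q :
  pi1_mul (pi1_class p) (pi1_class q) = pi1_class (concat p q).
Proof.
by apply/pi1_classP; apply: homotopic_concat; exact: homotopic_repr.
Qed.

Lemma pi1_invE p : pi1_inv (pi1_class p) = pi1_class (reverse p).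
Proof. by apply/pi1_classP; apply: homotopic_reverse; exact: homotopic_repr. Qed.

Fact pi1_mulA : associative pi1_mul.
Proof.
move=> a b c; rewrite -(pi1_repr a) -(pi1_repr b) -(pi1_repr c) !pi1_mulE.
by apply/pi1_classP; exact: homotopic_concatA.
Qed.

Fact pi1_mul1 : left_id pi1_one pi1_mul.
Proof.
move=> a; rewrite -(pi1_repr a) pi1_mulE.
by apply/pi1_classP; exact: homotopic_concat_cstl.
Qed.

Fact pi1_mulr1 : right_id pi1_one pi1_mul.
Proof.
move=> a; rewrite -(pi1_repr a) pi1_mulE.
by apply/pi1_classP; exact: homotopic_concat_cstr.
Qed.

Fact pi1_mulV : left_inverse pi1_one pi1_inv pi1_mul.
Proof.
move=> a; rewrite -(pi1_repr a) pi1_invE pi1_mulE.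
by apply/pi1_classP; exact: homotopic_concat_reversel.
Qed.

Fact pi1_mulrV : right_inverse pi1_one pi1_inv pi1_mul.
Proof.
move=> a; rewrite -(pi1_repr a) pi1_invE pi1_mulE.
by apply/pi1_classP; exact: homotopic_concat_reverser.
Qed.

HB.instance Definition _ :=
  isGroup.Build pi1 pi1_mulA pi1_mul1 pi1_mulr1 pi1_mulV pi1_mulrV.

Lemma pi1_classM p q :
  pi1_class (concat p q) = (pi1_class p * pi1_class q)%g.
Proof. by rewrite -pi1_mulE. Qed.

Lemma pi1_class1 : pi1_class (constant_path R x0) = 1%g.
Proof. by []. Qed.

Lemma pi1_classV p : pi1_class (reverse p) = (pi1_class p)^-1%g.
Proof. by rewrite -pi1_invE. Qed.

End FundamentalGroup.

Section InducedMap.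
Variables (R : realType) (X Y : topologicalType) (x0 : X) (y0 : Y) (f : X -> Y).
Hypotheses (f_cts : continuous f) (f_base : f x0 = y0).
Local Notation I := (unit_interval R).

Section Push.
Variable p : {path I from x0 to x0 in X}.

Fact push_continuous : continuous (fun t => f (p t)).
Proof. by apply: (comp_continuous (g := f)) => //; exact: cts_fun. Qed.

Fact push_zero : f (p zero) = y0.
Proof. by rewrite path_zero. Qed.

Fact push_one : f (p one) = y0.
Proof. by rewrite path_one. Qed.

Definition push : {path I from y0 to y0 in Y} :=
  mk_path push_continuous push_zero push_one.

End Push.

Lemma homotopic_push p q : homotopic p q -> homotopic (push p) (push q).
Proof.
move=> [H [cH H0 H1 He]]; exists (fun z => f (H z)); split=> [|t|t|s].
- exact: comp_continuous cH f_cts.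
- by rewrite H0.
- by rewrite H1.
- by rewrite (He s).1 (He s).2.
Qed.

Lemma push_concat p q : push (concat p q) = concat (push p) (push q).
Proof.
apply/path_eqP => t; rewrite /= /mk_path /= /mk_path /concat_fun.
by case: ifP.
Qed.

(* The homomorphism induced by a continuous map with f x0 = y0. *)
Definition pi1_map (a : pi1 R x0) : pi1 R y0 := pi1_class (push (repr a)).

Lemma pi1_mapE p : pi1_map (pi1_class p) = pi1_class (push p).
Proof. by apply/pi1_classP; apply: homotopic_push; exact: homotopic_repr. Qed.

Lemma pi1_mapM : {morph pi1_map : a b / (a * b)%g}.
Proof.
move=> a b; rewrite {2 3}/pi1_map -pi1_classM -push_concat -pi1_mapE.
by rewrite pi1_classM !pi1_repr.
Qed.

Lemma pi1_map1 : pi1_map 1%g = 1%g.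
Proof.
rewrite -[in LHS]pi1_class1 pi1_mapE -pi1_class1.
by apply/pi1_classP; exact: homotopic_ext.
Qed.

HB.instance Definition _ := isUMagmaMorphism.Build
  (pi1 R x0) (pi1 R y0) pi1_map (pi1_map1, pi1_mapM).

End InducedMap.

Section ProductGroup.
Variables (J : Type) (G : J -> groupType).

(* The product of a possibly dependent family of groups, with the componentwise
   law. *)
Definition group_prod : Type := forall j, G j.

HB.instance Definition _ := gen_eqMixin group_prod.
HB.instance Definition _ := gen_choiceMixin group_prod.

Definition group_prod_mul (g h : group_prod) : group_prod :=
  fun j => (g j * h j)%g.
Definition group_prod_one : group_prod := fun j => 1%g.
Definition group_prod_inv (g : group_prod) : group_prod := fun j => (g j)^-1%g.

Fact group_prod_mulA : associative group_prod_mul.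
Proof. by move=> g h k; apply: functional_extensionality_dep => j; exact: mulgA. Qed.
Fact group_prod_mul1 : left_id group_prod_one group_prod_mul.
Proof. by move=> g; apply: functional_extensionality_dep => j; exact: mul1g. Qed.
Fact group_prod_mulr1 : right_id group_prod_one group_prod_mul.
Proof. by move=> g; apply: functional_extensionality_dep => j; exact: mulg1. Qed.
Fact group_prod_mulV : left_inverse group_prod_one group_prod_inv group_prod_mul.
Proof. by move=> g; apply: functional_extensionality_dep => j; exact: mulVg. Qed.
Fact group_prod_mulrV :
  right_inverse group_prod_one group_prod_inv group_prod_mul.
Proof. by move=> g; apply: functional_extensionality_dep => j; exact: mulgV. Qed.

HB.instance Definition _ := isGroup.Build group_prod group_prod_mulA
  group_prod_mul1 group_prod_mulr1 group_prod_mulV group_prod_mulrV.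

End ProductGroup.

Record sgraph := SGraph {
  vertices :> finType;
  edge : rel vertices;
  edge_sym : symmetric edge;
  edge_irr : irreflexive edge
}.

Section CompleteGraph.
Variable J : finType.

Fact neq_sym : symmetric (fun i j : J => i != j).
Proof. by move=> i j; rewrite eq_sym. Qed.

Fact neq_irr : irreflexive (fun i j : J => i != j).
Proof. by move=> i; rewrite eqxx. Qed.

Definition complete_graph : sgraph := SGraph neq_sym neq_irr.

End CompleteGraph.

(* A cycle of length at most 2 would be a back-and-forth along an edge. *)
Definition is_tree (G : sgraph) : Prop :=
  (forall u v : G, connect (@edge G) u v) /\
  (forall c : seq G, (2 < size c)%N -> ~ ucycle (@edge G) c).

Record rooted_tree := RootedTree {
  tree_graph :> sgraph;
  root : tree_graph;
  treeP : is_tree tree_graph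
}.

Section TreeOrder.
Variable T : rooted_tree.

(* The vertices of the unique simple path from s to the root. *)
Definition root_path (s : T) : {set T} :=
  [set v | `[< exists p : seq T, [/\ path (@edge T) s p, uniq (s :: p),
                                     last s p = root T & v \in s :: p] >]].

Definition tree_le (s t : T) : bool := root_path s \subset root_path t.

Definition tree_comparable (s t : T) : bool :=
  (s != t) && (tree_le s t || tree_le t s).

Fact tree_comparable_sym : symmetric tree_comparable.
Proof. by move=> s t; rewrite /tree_comparable eq_sym orbC. Qed.

Fact tree_comparable_irr : irreflexive tree_comparable.
Proof. by move=> s; rewrite /tree_comparable eqxx. Qed.

Definition comparability_graph : sgraph :=
  SGraph tree_comparable_sym tree_comparable_irr.

End TreeOrder.

Lemma ptws_continuous (Z W : topologicalType) (V : Type)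
    (f : Z -> {ptws V -> W}) :
  (forall v, continuous (fun z => f z v)) -> continuous f.
Proof.
move=> cf z.
have FF : Filter (f x @[x --> z]) by apply: fmap_filter.
apply/(@cvg_sup _ _ _ _ _ FF) => v.
exact: (@continuous_comp_initial _ _ _ (fun g : {ptws V -> W} => g v) f (cf v) z).
Qed.

(* R[i]^o is the complex field with the topology of its modulus; {ptws _} is the
   product topology, and the coercion of a set to a type gives it the subspace
   topology. *)
Definition config_space (R : realType) (G : sgraph) : set {ptws G -> R[i]^o} :=
  [set x | forall i j, edge i j -> x i <> x j].
Arguments config_space : clear implicits.

Section BasePoint.
Variables (R : realType) (G : sgraph) (b : G -> R[i]) (b_inj : injective b).

Fact base_point_in : b \in config_space R G.
Proof. by rewrite inE => i j ij /b_inj eij; rewrite eij edge_irr in ij. Qed.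

(* A point with pairwise distinct coordinates lies in every configuration
   space. *)
Definition base_point : config_space R G :=
  exist (fun x => x \in config_space R G) b base_point_in.

Definition Gamma : groupType := pi1 R base_point.

End BasePoint.

Section PureBraids.
Variable R : realType.

Definition pure_braid (J : finType) (b : J -> R[i]) (b_inj : injective b) :
  groupType := @Gamma R (complete_graph J) b b_inj.

Variables (S : finType) (A B : {set S}) (AB : A \subset B).
Local Notation XA := (config_space R (complete_graph {v | v \in A})).
Local Notation XB := (config_space R (complete_graph {v | v \in B})).

Definition sub_incl (v : {v | v \in A}) : {v | v \in B} :=
  exist _ (val v) (fintype.subsetP AB _ (valP v)).

Fact restrict_in (x : XB) : (fun v => set_val x (sub_incl v)) \in XA.
Proof.
rewrite inE => i j /= ij; apply: (set_valP x) => /=.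
by apply: contra_neq ij => /(congr1 val)/= ?; exact: val_inj.
Qed.

Definition restrict (x : XB) : XA :=
  exist (fun y => y \in XA) (fun v => set_val x (sub_incl v)) (restrict_in x).

Fact restrict_continuous : continuous restrict.
Proof.
apply: continuous_comp_initial; apply: ptws_continuous => v.
apply: (@comp_continuous _ _ _ (fun f : {ptws _ -> R[i]^o} => f (sub_incl v))).
  exact: initial_continuous.
exact: proj_continuous.
Qed.

Variables (b : S -> R[i]) (b_inj : injective b).

Fact inj_on (D : {set S}) : injective (fun v : {v | v \in D} => b (val v)).
Proof. by move=> u v /b_inj/val_inj. Qed.

Definition base_on (D : {set S}) :
    config_space R (complete_graph {v | v \in D}) :=
  base_point (G := complete_graph {v | v \in D}) (@inj_on D).

Fact restrict_base : restrict (base_on B) = base_on A.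
Proof. exact: val_inj. Qed.

Definition braid_proj :
    UMagmaMorphism.type (pure_braid (@inj_on B)) (pure_braid (@inj_on A)) :=
  pi1_map restrict_continuous restrict_base.

End PureBraids.

Section Limit.
Variables (R : realType) (T : rooted_tree) (b : T -> R[i]).
Variable b_inj : injective b.

Definition Gamma_tree : groupType :=
  @Gamma R (comparability_graph T) b b_inj.

Definition tree_braid (s : T) : groupType :=
  pure_braid (@inj_on _ _ _ b_inj (root_path s)).

Definition rho (s' s : T) (le : tree_le s' s) :
  UMagmaMorphism.type (tree_braid s) (tree_braid s') := braid_proj le b_inj.

(* tree_le s' s means s' <= s, and rho projects from the longer path of s. *)
Definition compatible : {pred group_prod tree_braid} :=
  fun g => `[< forall (s' s : T) (le : tree_le s' s), rho le (g s) = g s' >].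

Fact compatible_group : group_closed compatible.
Proof.
split; first by apply/asboolP => s' s le; exact: gmulf1.
move=> g h /asboolP gP /asboolP hP; apply/asboolP => s' s le.
rewrite -[RHS]/(g s' / h s')%g -(gP s' s le) -(hP s' s le).
exact: gmulfF.
Qed.

Definition compatible_family : Type := {g | g \in compatible}.

HB.instance Definition _ := SubChoice.on compatible_family.
HB.instance Definition _ :=
  SubChoice_isSubGroup.Build (group_prod tree_braid) compatible
    compatible_family compatible_group.

Definition tree_lim : groupType := compatible_family.

End Limit.

(* Main.v *)
Require Import Defs.
From HB Require Import structures.
From mathcomp Require Import all_boot all_order all_algebra.
From mathcomp Require Import monoid.
From mathcomp Require Import complex lra interval_inference zify.
From mathcomp Require Import all_classical all_reals topology normedtype.
From mathcomp Require Import homotopy.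

Set Implicit Arguments.
Unset Strict Implicit.
Unset Printing Implicit Defensive.

Import Order.TTheory GRing.Theory Num.Theory.
Import numFieldNormedType.Exports.

Local Open Scope classical_set_scope.
Local Open Scope ring_scope.
Local Open Scope complex_scope.

(** Write [X] for the configuration space of the comparability graph and
[X_s] for that of the strands on the path from [s] to the root.  A point of
[X_s] is a point of the configuration space of the strands strictly below [s],
together with one more point of the plane avoiding them; forgetting that point
is a fibration which has a section.  Attaching the vertices of the tree one at a
time, lower vertices first, exhibits [X] as an iterated fibre product of these
fibrations, because the strands comparable with a new vertex [s] among those
already present are exactly the strands below [s].  For the fibre product of two
fibrations with sections, the fundamental group is the fibre product of the
fundamental groups; the theorem is the resulting limit.

The proof makes this explicit with strands in the plane.

Homotopy lifting ([lift_point]): given distinct moving strands, a point that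
avoids them at time 0 can be moved so as to avoid them at all times.  For a
displacement small compared with the distances between the strands, an explicit
injective map of the plane carries the strands to their new positions
([transport]); compactness cuts any motion into finitely many displacements of
this kind.

Surjectivity ([assembled_loop_exists]): a loop in [X] is built strand by strand.
The strands below [s] that have been chosen are homotopic to the lower strands
of the loop prescribed in [X_s], by compatibility; lifting that homotopy,
starting from the last strand of the prescribed loop, gives the strand of [s].

Injectivity ([homotopic_to_constant]): a null homotopy in [X] is built strand by
strand.  Over [s], the strands below carry a null homotopy [h] already chosen
and another one, [k], coming from [X_s], and only [k] comes with a null homotopy
of the strand [s].  The two together form a sphere of configurations, whose
class in the second homotopy group could obstruct the transfer from [k] to [h];
the section of the fibration ([config_section]) makes this obstruction vanish
([null_homotopy_transfer]). *)

(** * The real modulus of a complex number *)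

Section Modulus.
Variable R : realType.
Implicit Types (z w : R[i]) (r : R).

(** The norm of [R[i]] takes its values in [R[i]], which is only partially
ordered; estimates are easier to combine in [R]. *)
Definition modulus z : R := complex.Re `|z|.

Lemma modulusE z : `|z| = (modulus z)%:C.
Proof. by rewrite /modulus normc_def. Qed.

Lemma modulus_ge0 z : 0 <= modulus z.
Proof. by rewrite -ler0c -modulusE. Qed.

Lemma modulus_eq0 z : (modulus z == 0) = (z == 0).
Proof. by rewrite -[RHS]normr_eq0 modulusE eq_complex /= eqxx andbT. Qed.

Lemma modulus_gt0 z : (0 < modulus z) = (z != 0).
Proof. by rewrite lt_def modulus_ge0 andbT modulus_eq0. Qed.

Lemma modulus0 : modulus 0 = 0.
Proof. by apply/eqP; rewrite modulus_eq0. Qed.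

Lemma modulusN z : modulus (- z) = modulus z.
Proof. by rewrite /modulus normrN. Qed.

Lemma modulus_distC z w : modulus (z - w) = modulus (w - z).
Proof. by rewrite -modulusN opprB. Qed.

Lemma modulusM z w : modulus (z * w) = modulus z * modulus w.
Proof.
by apply: (@complexI R); rewrite rmorphM /= -!modulusE normrM.
Qed.

Lemma modulusD z w : modulus (z + w) <= modulus z + modulus w.
Proof. by rewrite -lecR rmorphD /= -!modulusE ler_normD. Qed.

Lemma modulus_real r : modulus r%:C = `|r|.
Proof. by rewrite /modulus normc_def /= expr0n addr0 sqrtr_sqr. Qed.

Lemma modulus_dist z w : `|modulus z - modulus w| <= modulus (z - w).
Proof.
have tri u v : modulus u - modulus v <= modulus (u - v).
  by rewrite lerBlDr -{1}(subrK v u) modulusD.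
by rewrite ler_norml tri andbT lerNl opprB modulus_distC tri.
Qed.

Lemma modulus_sum (J : finType) (f : J -> R[i]) :
  modulus (\sum_j f j) <= \sum_j modulus (f j).
Proof.
elim/big_rec2 : _ => [|j x y _ le_xy]; first by rewrite modulus0.
by apply: le_trans (modulusD _ _) _; rewrite lerD2l.
Qed.

Lemma normr_Re_le z : `|complex.Re z| <= modulus z.
Proof.
rewrite /modulus normc_def /= -sqrtr_sqr ler_wsqrtr // lerDl.
exact: sqr_ge0.
Qed.

Lemma normr_Im_le z : `|complex.Im z| <= modulus z.
Proof.
rewrite /modulus normc_def /= -sqrtr_sqr ler_wsqrtr // lerDr.
exact: sqr_ge0.
Qed.

End Modulus.

Lemma oppr_continuous (R : realType) (Z : topologicalType) (f : Z -> R) :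
  continuous f -> continuous (fun z => - f z).
Proof. by move=> cf z; apply: cvgN; exact: cf. Qed.

Section ComplexContinuity.
Variables (R : realType) (Z : topologicalType).

Lemma modulus_continuous (f : Z -> R[i]^o) :
  continuous f -> continuous (fun z => modulus (f z)).
Proof.
move=> cf z; apply/cvgrPdist_lt => e e0.
have eC0 : 0 < e%:C :> R[i] by rewrite -[X in X < _]/(0%:C) ltcR.
have /cvgrPdist_lt/(_ _ eC0) := cf z; apply: filterS => t.
rewrite modulusE ltcR; apply: le_lt_trans.
exact: modulus_dist.
Qed.

Lemma real_complex_continuous (f : Z -> R) :
  continuous f -> continuous (fun z => (f z)%:C : R[i]^o).
Proof.
move=> cf z; apply/cvgrPdist_lt => e e0.
have eE : e = (complex.Re e)%:C.
  by apply/esym/RRe_real; rewrite ger0_real // ltW.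
move: e0; rewrite eE -[X in X < _]/(0%:C) ltcR => e0.
have /cvgrPdist_lt/(_ _ e0) := cf z; apply: filterS => t.
by rewrite -rmorphB /= modulusE modulus_real ltcR.
Qed.

Lemma caddr_continuous (f g : Z -> R[i]^o) :
  continuous f -> continuous g -> continuous (fun z => f z + g z : R[i]^o).
Proof. by move=> cf cg z; apply: cvgD; [exact: cf|exact: cg]. Qed.

Lemma csubr_continuous (f g : Z -> R[i]^o) :
  continuous f -> continuous g -> continuous (fun z => f z - g z : R[i]^o).
Proof. by move=> cf cg z; apply: cvgB; [exact: cf|exact: cg]. Qed.

Lemma cmulr_continuous (f g : Z -> R[i]^o) :
  continuous f -> continuous g -> continuous (fun z => f z * g z : R[i]^o).
Proof. by move=> cf cg z; apply: cvgM; [exact: cf|exact: cg]. Qed.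

Lemma sum_continuous (K : numFieldType) (J : finType) (f : J -> Z -> K^o) :
  (forall j, continuous (f j)) -> continuous (fun z => \sum_j f j z : K^o).
Proof.
move=> cf; elim: (index_enum J) => [|j s IHs].
  by under eq_fun do rewrite big_nil; exact: cst_continuous.
under eq_fun do rewrite big_cons.
by move=> z; apply: cvgD; [exact: cf|exact: IHs].
Qed.

End ComplexContinuity.

(** * Uniform estimates on compact spaces *)

Section Compactness.
Variable R : realType.
Local Notation I := (unit_interval R).

Lemma unit_interval_compact : compact [set: I].
Proof.
rewrite (_ : [set: I] = @clamp R @` `[0, 1]); last first.
  apply/seteqP; split=> // t _; exists (ival t); last exact: clampK.
  by rewrite /= in_itv /= ival_ge0 ival_le1.
apply: continuous_compact; last exact: segment_compact.
exact/continuous_subspaceT/clamp_continuous.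
Qed.

Lemma square_compact : compact [set: I * I].
Proof.
rewrite -setXTT.
exact: (compact_setX unit_interval_compact unit_interval_compact).
Qed.

End Compactness.

Section Uniformity.
Variables (R : realType).
Local Notation I := (unit_interval R).
Local Notation C := (R[i]^o).

Lemma eventually_invn (e : R) : 0 < e -> \forall n \near \oo, n.+1%:R^-1 < e.
Proof. by move=> /posnumP[d]; exact: near_infty_natSinv_lt. Qed.

(** Being eventually true, locally uniformly, is being true at some common stage
on a compact space; both uniform estimates below are instances. *)
Lemma compact_eventually (Z : topologicalType) (P : nat -> Z -> Prop) :
  compact [set: Z] ->
  (forall z : Z, filter_prod (nbhs z) \oo (fun w => P w.2 w.1)) ->
  exists n, forall z, P n z.
Proof.
move=> Zcompact nearP; have [|N _ PN] :=
  (compact_near_coveringP [set: Z]).1 Zcompact nat \oo P _.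
  by move=> z _; exact: nearP.
by exists N => z; exact: PN (leqnn N) z Logic.I.
Qed.

Lemma uniform_gap (Z : topologicalType) (J : finType) (x : J -> Z -> C) :
  compact [set: Z] ->
  (forall j, continuous (x j)) ->
  (forall i j, i != j -> forall z, x i z != x j z) ->
  exists2 r, 0 < r &
    forall i j, i != j -> forall z, r < modulus (x i z - x j z).
Proof.
move=> Zcompact x_cts x_neq.
have [z|n nP] := compact_eventually (P := fun n z => forall i j, i != j ->
  n.+1%:R^-1 < modulus (x i z - x j z)) Zcompact.
  have FF : Filter (filter_prod (nbhs z) \oo) by exact: filter_prod_filter.
  apply: (@filter_forall _ _ _ _ FF) => i.
  apply: (@filter_forall _ _ _ _ FF) => j.
  have [->|ij] := eqVneq i j; first by apply: filterE => w /negP[].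
  set m := modulus (x i z - x j z).
  have m0 : 0 < m by rewrite modulus_gt0 subr_eq0 x_neq.
  exists ([set w | m / 2 < modulus (x i w - x j w)],
          [set n | n.+1%:R^-1 < m / 2]).
    split=> /=; last by apply: eventually_invn; rewrite divr_gt0.
    have cm := modulus_continuous (csubr_continuous (x_cts i) (x_cts j)) (x:=z).
    by apply: (cvgr_gt _ cm); rewrite ltr_pdivrMr // ltr_pMr // ltr1n.
  by move=> [w n] /= [w_m n_m] _; exact: lt_trans w_m.
by exists n.+1%:R^-1; rewrite ?invr_gt0 //; move=> i j ij z; exact: nP.
Qed.

Lemma uniform_continuity (Z : topologicalType) (J : finType)
    (x : J -> Z * I -> C) (r : R) :
  compact [set: Z * I] ->
  (forall j, continuous (x j)) -> 0 < r ->
  exists n, forall u t t', `|ival t - ival t'| <= n.+1%:R^-1 ->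
    \sum_j modulus (x j (u, t) - x j (u, t')) < r.
Proof.
move=> ZIcompact x_cts r0.
(* The second time is written as the first plus a shift, so that the diagonal
   becomes the slice of shift 0, where g vanishes. *)
pose g (w : (Z * I) * R) : R :=
  \sum_j modulus (x j w.1 - x j (w.1.1, clamp (ival w.1.2 + w.2))).
have g_cts : continuous g.
  apply: (sum_continuous (K := R)) => j.
  apply: modulus_continuous; apply: csubr_continuous.
    exact: comp_continuous (@fst_continuous _ _) (x_cts j).
  apply: comp_continuous (x_cts j); continuity.
  - exact: comp_continuous (@fst_continuous _ _) (@fst_continuous _ _).
  - exact: comp_continuous (@fst_continuous _ _) (@snd_continuous _ _).
have [[u t]|n nP] := compact_eventually (P := fun n z => forall s : R,
  `|s| <= n.+1%:R^-1 -> g (z, s) < r) ZIcompact.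
  have g0 : g ((u, t), 0) = 0.
    by rewrite /g big1 // => j _ /=; rewrite addr0 clampK subrr modulus0.
  have := cvgr_lt _ (g_cts ((u, t), 0)); rewrite g0 => /(_ _ r r0)[].
  move=> [A B] /= [nA [e /= e0 Be]] AB.
  exists (A, [set n | n.+1%:R^-1 < e]) => /=.
    by split=> //; exact: eventually_invn.
  move=> [z n] /= [Az ne] s sn; apply: (AB (z, s)); split=> //=.
  by apply: Be; rewrite /ball_ /= sub0r normrN; exact: le_lt_trans ne.
exists n => u t t' tt'.
have := nP (u, t) (ival t' - ival t); rewrite distrC => /(_ tt').
by rewrite /g /= addrC subrK clampK.
Qed.

End Uniformity.

(** * Moving a point among moving strands *)

Section Transport.
Variables (R : realType) (J : finType) (r : R).
Hypothesis r_gt0 : 0 < r.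
Implicit Types x y : J -> R[i].

Definition bump (a z : R[i]) : R := Num.max 0 (1 - modulus (z - a) / r).

(** When the points of [x] are at mutual distance more than [r] and the total
displacement from [x] to [y] is less than [r], this map of the plane carries
each [x j] to [y j] without identifying points, so it takes the complement of
[x] into that of [y]. *)
Definition transport x y (z : R[i]) : R[i] :=
  z + \sum_j (bump (x j) z)%:C * (y j - x j).

Lemma bump_lipschitz a z w : `|bump a z - bump a w| <= modulus (z - w) / r.
Proof.
have lip u v : bump a u <= bump a v + modulus (u - v) / r.
  rewrite /bump ge_max; apply/andP; split.
    by rewrite addr_ge0 ?le_max ?lexx // divr_ge0 ?modulus_ge0 // ltW.
  apply: (@le_trans _ _ (1 - modulus (v - a) / r + modulus (u - v) / r)).
    suff : modulus (v - a) / r <= modulus (u - v) / r + modulus (u - a) / r.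
      by lra.
    rewrite -mulrDl ler_pM2r ?invr_gt0 // (modulus_distC u v).
    by rewrite -[v - a](subrKA u) modulusD.
  by rewrite lerD2r le_max lexx orbT.
rewrite ler_norml lerBlDl lip andbT lerNl opprB lerBlDl modulus_distC.
exact: lip.
Qed.

(** The map is the identity plus a perturbation whose Lipschitz constant is less
than 1. *)
Lemma transport_inj x y : \sum_j modulus (y j - x j) < r ->
  injective (transport x y).
Proof.
move=> xy_r z w eq_zw; apply/eqP; rewrite -subr_eq0 -modulus_eq0.
rewrite eq_le modulus_ge0 andbT leNgt; apply/negP => zw_gt0.
have := xy_r; rewrite ltNge => /negP; apply.
have zwE : z - w = \sum_j (bump (x j) w - bump (x j) z)%:C * (y j - x j).
  transitivity (\sum_j (bump (x j) w)%:C * (y j - x j)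
                - \sum_j (bump (x j) z)%:C * (y j - x j)).
    apply/eqP; rewrite subr_eq addrAC -subr_eq opprK.
    by rewrite [X in _ == X]addrC -/(transport x y w) -eq_zw.
  by rewrite -sumrB; apply: eq_bigr => j _; rewrite rmorphB mulrBl.
have : modulus (z - w) <= modulus (z - w) / r * \sum_j modulus (y j - x j).
  rewrite {1}zwE mulr_sumr; apply: le_trans (modulus_sum _) _.
  apply: ler_sum => j _; rewrite modulusM modulus_real.
  apply: ler_wpM2r; first exact: modulus_ge0.
  by rewrite distrC bump_lipschitz.
by rewrite -mulrA ler_pMr // mulrC ler_pdivlMr // mul1r.
Qed.

Lemma transport_point x y i :
  (forall j, j != i -> r < modulus (x i - x j)) -> transport x y (x i) = y i.
Proof.
move=> far; rewrite /transport (bigD1 i) //= /bump subrr modulus0 mul0r subr0.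
rewrite (max_idPr ler01) mul1r addrA [x i + _]addrC subrK.
rewrite big1 ?addr0 // => j ji.
rewrite (max_idPl _) ?mul0r // subr_le0 ler_pdivlMr // mul1r ltW //.
exact: far.
Qed.

Lemma transport_eq x y z : (forall j, x j = y j) -> transport x y z = z.
Proof.
by move=> xy; rewrite /transport big1 ?addr0 // => j _; rewrite xy subrr mulr0.
Qed.

Lemma transport_continuous (Z : topologicalType) (x y : J -> Z -> R[i]^o)
    (f : Z -> R[i]^o) :
  (forall j, continuous (x j)) -> (forall j, continuous (y j)) ->
  continuous f ->
  continuous (fun z => transport (x^~ z) (y^~ z) (f z) : R[i]^o).
Proof.
move=> cx cy cf.
have bump_cts j : continuous (fun z => bump (x j z) (f z)).
  apply: (Defs.max_continuous (f := fun=> 0)); first exact: cst_continuous.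
  apply: (subr_continuous (f := fun=> 1)); first exact: cst_continuous.
  apply: (mulr_continuous (g := fun=> r^-1)); last exact: cst_continuous.
  exact: (modulus_continuous (csubr_continuous cf (cx j))).
have term_cts j :
    continuous (fun z => (bump (x j z) (f z))%:C * (y j z - x j z) : R[i]^o).
  apply: (cmulr_continuous (f := fun z => (bump (x j z) (f z))%:C)).
    exact: real_complex_continuous.
  exact: (csubr_continuous (cy j) (cx j)).
exact: (caddr_continuous cf (sum_continuous term_cts)).
Qed.

End Transport.

Section Lift.
Variables (R : realType) (Z : topologicalType) (J : finType).
Local Notation I := (unit_interval R).
Local Notation C := (R[i]^o).

(** Homotopy lifting for the map that forgets one point of a configuration.
The last clause keeps the lift constant over the parameters where the
configuration does not move, which is how boundary conditions are preserved. *)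
Lemma lift_point (x : J -> Z * I -> C) (z0 : Z -> C) :
  compact [set: Z * I] -> (forall j, continuous (x j)) ->
  (forall i j, i != j -> forall z, x i z != x j z) ->
  continuous z0 -> (forall j u, x j (u, zero) != z0 u) ->
  exists f : Z * I -> C,
    [/\ continuous f, forall u, f (u, zero) = z0 u,
        forall j z, x j z != f z &
        forall u, (forall j t, x j (u, t) = x j (u, zero)) ->
          forall t, f (u, t) = z0 u].
Proof.
move=> ZI x_cts x_neq z0_cts z0_x.
have [r r0 gap] := uniform_gap ZI x_cts x_neq.
have [n close] := uniform_continuity ZI x_cts r0.
(* The k-th approximation follows the strands up to time k/(n+1) and then stops;
   stopping all motions at once makes each step continuous in all variables,
   so that no gluing of successive time intervals is needed. *)
pose cut k (t : I) : I := clamp (Num.min (ival t) (k%:R / n.+1%:R)).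
pose xk k j (z : Z * I) : C := x j (z.1, cut k z.2).
pose fix f k (z : Z * I) {struct k} : C :=
  if k is k'.+1 then transport r (xk k' ^~ z) (xk k ^~ z) (f k' z) else z0 z.1.
have cutE k t : ival (cut k t) = Num.min (ival t) (k%:R / n.+1%:R).
  rewrite ival_clamp // ?le_min ?ival_ge0 ?divr_ge0 //.
  by rewrite ge_min ival_le1.
have cut_close k t : `|ival (cut k.+1 t) - ival (cut k t)| <= n.+1%:R^-1.
  rewrite !cutE -natr1 mulrDl mul1r.
  have n0 : 0 < n.+1%:R^-1 :> R by rewrite invr_gt0.
  move: n0; set e := n.+1%:R^-1; set s := _ / _; set v := ival t => n0.
  by rewrite ler_norml; case: (leP v s); case: (leP v (s + e)); lra.
have cut_cts k : continuous (cut k).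
  apply: clamp_comp_continuous; apply: Defs.min_continuous.
    exact: ival_continuous.
  exact: cst_continuous.
have xk_cts k j : continuous (xk k j).
  apply: comp_continuous (x_cts j).
  apply: pair_continuous; first exact: fst_continuous.
  exact: comp_continuous (@snd_continuous _ _) (cut_cts k).
have xk_neq k z i j : i != j -> r < modulus (xk k i z - xk k j z).
  by move=> ij; exact: gap.
have f_cts k : continuous (f k).
  elim: k => [|k IHk] /=.
    exact: comp_continuous (@fst_continuous _ _) z0_cts.
  exact: (transport_continuous (xk_cts k) (xk_cts k.+1) IHk).
have f_neq k j z : xk k j z != f k z.
  elim: k j z => [|k IHk] j z /=.
    rewrite /xk /cut mul0r (min_idPr (ival_ge0 _)); exact: z0_x.
  have <- : transport r (xk k ^~ z) (xk k.+1 ^~ z) (xk k j z) = xk k.+1 j z.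
    by apply: transport_point => // i ij; apply: xk_neq; rewrite eq_sym.
  rewrite (inj_eq (transport_inj _ _)) //.
  exact/close/cut_close.
exists (f n.+1); split=> [|u|j z|u xu t].
- exact: f_cts.
- elim: n.+1 => [|k IHk] //=; rewrite transport_eq // => j.
  congr (x j (_, _)); apply: ival_inj; rewrite !cutE ival0.
  by rewrite !(min_idPl _) // divr_ge0.
- rewrite -[X in x j X]/z; have -> : x j z = xk n.+1 j z.
    rewrite /xk /cut divff ?pnatr_eq0 // (min_idPl (ival_le1 _)) clampK.
    by case: z.
  exact: f_neq.
- elim: n.+1 => [|k IHk] //=; rewrite transport_eq // => j.
  by rewrite /xk /= xu [RHS]xu.
Qed.

End Lift.

(** * Transferring null homotopies *)

Section FreePoint.
Variables (R : realType) (J : finType).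
Local Notation C := (R[i]^o).
Implicit Types x b : J -> R[i].

(** The fibration that forgets one point has a section through any prescribed
point: push [c] along a line that avoids [b], by a distance proportional to the
displacement [d x] of the configuration from [b].  As long as the displacement
is small, no strand reaches the line.  When it is not, a large factor [L] of
proportionality takes the pushed point farther from [c] than any strand. *)
Lemma config_section b (c : R[i]) : (forall j, b j != c) ->
  exists s : (J -> R[i]) -> R[i],
    [/\ forall x, (forall j, x j = b j) -> s x = c,
        forall x j, x j != s x &
        forall (Z : topologicalType) (x : J -> Z -> C),
          (forall j, continuous (x j)) ->
          continuous (fun z => s (x^~ z) : C)].
Proof.
move=> b_c.
pose d x : R := \sum_j modulus (x j - b j).
have d_ge0 x : 0 <= d x by apply: sumr_ge0 => j _; exact: modulus_ge0.
have le_d x j : modulus (x j - b j) <= d x.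
  rewrite /d (bigD1 j) //= lerDl; apply: sumr_ge0 => i _; exact: modulus_ge0.
(* The line through c of slope m meets no b j once m exceeds all these slopes in
   absolute value; the inverse of 0 is 0, which is harmless since b j lies
   straight above or below c in that case. *)
pose slope j : R := `|complex.Im (b j - c) / complex.Re (b j - c)|.
have [m m0 m_gt] : exists2 m, 0 < m & forall j, slope j < m.
  exists (1 + \sum_j slope j) => [|j].
    by rewrite ltr_pwDl // sumr_ge0 // => j _; exact: normr_ge0.
  rewrite (bigD1 j) //= addrCA ltrDl ltr_pwDl //.
  by apply: sumr_ge0 => i _; exact: normr_ge0.
pose w : R[i] := 1 +i* m.
(* A linear form that vanishes exactly on the direction of the line. *)
pose ell (z : R[i]) : R := complex.Im z - m * complex.Re z.
have ellD u v : ell (u + v) = ell u + ell v.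
  by case: u v => [u1 u2] [v1 v2]; rewrite /ell /=; lra.
have ellw (r : R) : ell (r%:C * w) = 0.
  by rewrite /ell /w /=; lra.
have ell_le z : `|ell z| <= (1 + m) * modulus z.
  apply: le_trans (ler_normB _ _) _; rewrite normrM (gtr0_norm m0) mulrDl mul1r.
  by apply: lerD; [exact: normr_Im_le|rewrite ler_pM2l // normr_Re_le].
have ell_b j : 0 < `|ell (b j - c)|.
  rewrite normr_gt0; apply/negP => /eqP ell0.
  have ImE : complex.Im (b j - c) = m * complex.Re (b j - c).
    by apply/eqP; rewrite -subr_eq0; apply/eqP.
  have [Re0|Re0] := eqVneq (complex.Re (b j - c)) 0.
    have := b_c j; rewrite -subr_eq0 eq_complex Re0 /= ImE Re0 mulr0.
    by rewrite eqxx.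
  by have := m_gt j; rewrite /slope ImE mulfK // gtr0_norm // ltxx.
(* The strand j cannot reach the line if it is displaced by less than e j. *)
pose e j : R := `|ell (b j - c)| / (1 + m).
have e0 j : 0 < e j by rewrite divr_gt0 // addr_gt0.
pose q j : R := modulus (b j - c) / e j.
have q0 j : 0 <= q j by rewrite divr_ge0 ?modulus_ge0 // ltW.
have [L L2 L_ge] : exists2 L, 2 <= L & forall j, 2 + q j <= L.
  exists (2 + \sum_j q j) => [|j]; first by rewrite lerDl sumr_ge0.
  by rewrite lerD2l (bigD1 j) //= lerDl sumr_ge0.
have L_gt j : modulus (b j - c) < (L - 1) * e j.
  apply: (@lt_le_trans _ _ ((1 + q j) * e j)).
    by rewrite mulrDl mul1r divfK ?gt_eqF // ltrDr.
  by rewrite ler_pM2r //; have := L_ge j; lra.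
exists (fun x => c + (L * d x)%:C * w); split=> [x xb|x j|Z x cx].
- rewrite (_ : d x = 0) ?mulr0 ?mul0r ?addr0 //.
  by apply: big1 => j _; rewrite xb subrr modulus0.
- apply/negP => /eqP xjE.
  have e_le_d : e j <= d x.
    apply: le_trans (le_d x j); rewrite /e ler_pdivrMr ?addr_gt0 // mulrC.
    apply: le_trans (ell_le _); rewrite -normrN.
    have -> : - ell (b j - c) = ell (x j - b j) - ell (x j - c).
      have -> : x j - c = (x j - b j) + (b j - c) by rewrite subrKA.
      by rewrite (ellD (x j - b j)); lra.
    by rewrite {2}xjE [c + _]addrC addrK ellw subr0.
  have Ld : L * d x <= modulus (x j - c).
    have w1 : 1 <= modulus w by apply: le_trans (normr_Re_le w); rewrite normr1.
    rewrite xjE [c + _]addrC addrK modulusM modulus_real.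
    apply: le_trans (ler_norm _) _; rewrite ler_peMr //.
  have xc : modulus (x j - c) <= d x + modulus (b j - c).
    rewrite -(subrKA (b j)); apply: le_trans (modulusD _ _) _.
    by rewrite lerD2r le_d.
  have := L_gt j; rewrite ltNge => /negP; apply.
  apply: (@le_trans _ _ ((L - 1) * d x)); last by lra.
  by rewrite ler_wpM2l //; lra.
- have dist_cts j : continuous (fun z => modulus (x j z - b j)).
    apply: (modulus_continuous (csubr_continuous (cx j) _)).
    exact: cst_continuous.
  have d_cts : continuous (fun z => L * d (x^~ z)).
    apply: (mulr_continuous (f := fun=> L)); first exact: cst_continuous.
    exact: (sum_continuous dist_cts).
  have := cmulr_continuous (real_complex_continuous d_cts)
    (@cst_continuous _ _ (w : C)).
  exact: (caddr_continuous (@cst_continuous _ _ (c : C))).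
Qed.

End FreePoint.

Section NullHomotopy.
Variables (R : realType) (J : finType).
Local Notation I := (unit_interval R).
Local Notation C := (R[i]^o).

(** Both [h] and [k] contract the same loop of configurations, and [f] contracts
one more strand over [k].  Run through [k] forwards, then backwards, and then
through [h]: this sweep is homotopic to [h] alone, and it has a lift, namely [f]
on the first run and the section on the rest; lifting the homotopy turns it
into a contraction of the strand over [h]. *)
Lemma null_homotopy_transfer (h k : J -> I * I -> C) (f : I * I -> C)
    (b : J -> R[i]) (c : R[i]) :
  (forall j, continuous (h j)) -> (forall j, continuous (k j)) ->
  continuous f ->
  (forall i j, i != j -> forall z, h i z != h j z) ->
  (forall i j, i != j -> forall z, k i z != k j z) ->
  (forall j z, k j z != f z) ->
  (forall j u, h j (u, zero) = k j (u, zero)) ->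
  (forall j t, [/\ h j (zero, t) = b j, h j (one, t) = b j &
                   h j (t, one) = b j]) ->
  (forall j t, [/\ k j (zero, t) = b j, k j (one, t) = b j &
                   k j (t, one) = b j]) ->
  (forall t, [/\ f (zero, t) = c, f (one, t) = c & f (t, one) = c]) ->
  exists g : I * I -> C,
    [/\ continuous g, forall j z, h j z != g z,
        forall u, g (u, zero) = f (u, zero) &
        forall t, [/\ g (zero, t) = c, g (one, t) = c & g (t, one) = c]].
Proof.
move=> h_cts k_cts f_cts h_neq k_neq k_f hk h_bd k_bd f_bd.
have b_c j : b j != c.
  by have := k_f j (zero, zero); have [-> _ _] := k_bd j zero;
     have [-> _ _] := f_bd zero.
have [s [s_b s_neq s_cts]] := config_section b_c.
(* k and h share their bottom edge; m is the union of the two squares. *)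
pose m j (w : I * R) : C :=
  if w.2 <= 0 then k j (w.1, clamp (- w.2)) else h j (w.1, clamp w.2).
have m_cts j : continuous (m j).
  apply: (glue_continuous (h := fun w : I * R => w.2)).
  - exact: snd_continuous.
  - apply: comp_continuous (k_cts j); apply: pair_continuous.
      exact: fst_continuous.
    exact/clamp_comp_continuous/oppr_continuous/snd_continuous.
  - apply: comp_continuous (h_cts j); continuity.
  - by move=> w ->; rewrite oppr0 hk.
have m_neq i j w : i != j -> m i w != m j w.
  by move=> ij; rewrite /m; case: ifP => _; [exact: k_neq|exact: h_neq].
have mh j u (t : I) : m j (u, ival t) = h j (u, t).
  rewrite /m /= clampK; case: ifP => // t0.
  have -> : t = zero.
    by apply: ival_inj; rewrite ival0; apply: le_anti; rewrite t0 ival_ge0.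
  by rewrite ival0 oppr0 hk.
have m_end j (v : R) : m j (zero, v) = b j /\ m j (one, v) = b j.
  rewrite /m /=; have [k0 k1 _] := k_bd j (clamp (- v)).
  by have [h0 h1 _] := h_bd j (clamp v); case: ifP.
(* The sweep: from 0 to -1 during the first third of the time, where f is used,
   and then from -1 to 1. *)
pose v (t : I) : R := Num.max (3 * ival t - 2) (- (3 * ival t)).
have v_cts : continuous v.
  have c3 : continuous (fun t : I => 3 * ival t) by continuity.
  apply: Defs.max_continuous; first by continuity.
  exact: oppr_continuous c3.
have v0 : v zero = 0 by rewrite /v ival0 (max_idPr _); lra.
have v1 : v one = 1 by rewrite /v ival1 (max_idPl _); lra.
pose G j (z : (I * I) * I) : C :=
  m j (z.1.1, (1 - ival z.2) * v z.1.2 + ival z.2 * ival z.1.2).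
(* The pieces agree at time 1/3 because the section passes through c. *)
pose f0 (z : I * I) : C :=
  if ival z.2 <= 3^-1 then f (z.1, clamp (3 * ival z.2))
  else s (fun j => m j (z.1, v z.2)).
have G_cts j : continuous (G j).
  apply: comp_continuous (m_cts j); apply: pair_continuous.
    exact: comp_continuous (@fst_continuous _ _) (@fst_continuous _ _).
  have c12 : continuous (fun z : (I * I) * I => z.1.2).
    exact: comp_continuous (@fst_continuous _ _) (@snd_continuous _ _).
  have cv : continuous (fun z : (I * I) * I => v z.1.2).
    exact: comp_continuous c12 v_cts.
  have ci : continuous (fun z : (I * I) * I => ival z.1.2).
    exact: comp_continuous c12 (@ival_continuous R).
  have c2 : continuous (fun z : (I * I) * I => ival z.2).
    exact: comp_continuous (@snd_continuous _ _) (@ival_continuous R).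
  apply: addr_continuous; apply: mulr_continuous => //.
  by apply: subr_continuous => //; exact: cst_continuous.
have f0_cts : continuous f0.
  apply: (glue_continuous (h := fun z : I * I => ival z.2)).
  - by continuity.
  - by apply: comp_continuous f_cts; continuity.
  - apply: s_cts => j; apply: comp_continuous (m_cts j).
    apply: pair_continuous; first exact: fst_continuous.
    exact: comp_continuous (@snd_continuous _ _) v_cts.
  - move=> z zE; rewrite zE divff ?pnatr_eq0 //.
    have -> : v z.2 = -1 by rewrite /v zE (max_idPr _); lra.
    have [_ _ ->] := f_bd z.1; rewrite s_b // => j.
    rewrite /m /= ifT; last by lra.
    by rewrite opprK; have [_ _ ->] := k_bd j z.1.
have G0 j z : G j (z, zero) = m j (z.1, v z.2).
  by rewrite /G /= ival0 subr0 mul1r mul0r addr0.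
have G_f0 j z : G j (z, zero) != f0 z.
  rewrite G0 /f0; case: ifP => zE; last exact: s_neq.
  have -> : v z.2 = - (3 * ival z.2) by rewrite /v (max_idPr _) //; lra.
  rewrite /m /= ifT; last by have := ival_ge0 z.2; lra.
  by rewrite opprK; exact: k_f.
have cube_compact : compact [set: (I * I) * I].
  rewrite -setXTT.
  exact: (compact_setX (@square_compact R) (@unit_interval_compact R)).
have G_neq i j : i != j -> forall z, G i z != G j z.
  by move=> ij z; exact: m_neq.
have [g [g_cts g0 G_g g_cst]] :=
  lift_point cube_compact G_cts G_neq f0_cts G_f0.
have f0_end t : f0 (zero, t) = c /\ f0 (one, t) = c.
  rewrite /f0 /=; have [fz fo _] := f_bd (clamp (3 * ival t)).
  by case: ifP => // _; split; rewrite s_b // => j; have [] := m_end j (v t).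
exists (fun z => g (z, one)); split=> [|j z|u|t].
- apply: (comp_continuous (f := fun z => (z, one))) g_cts.
  apply: (pair_continuous (f := id)); last exact: cst_continuous.
  by move=> z; exact: cvg_id.
- have := G_g j (z, one); rewrite /G /= ival1 subrr mul0r mul1r add0r mh.
  by case: z.
- rewrite g_cst => [|j t].
    rewrite /f0 /= ifT; last by rewrite ival0 invr_ge0.
    by rewrite ival0 mulr0.
  by rewrite /G /= v0 ival0 !mulr0 addr0.
- split; rewrite g_cst.
  + by have [] := f0_end t.
  + by move=> j t'; rewrite /G /=; rewrite !(m_end j _).1.
  + by have [] := f0_end t.
  + by move=> j t'; rewrite /G /=; rewrite !(m_end j _).2.
  + rewrite /f0 /= ival1 ifF; last by lra.
    rewrite s_b // => j; rewrite v1 -[1](ival1 R) mh.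
    by have [] := h_bd j t.
  + by move=> j t'; rewrite /G /= v1 ival1 !mulr1 !subrK.
Qed.

End NullHomotopy.

(** * Paths to the root *)

(** Two simple paths with different first steps and the same end would close up
into a cycle at the first vertex where the first path meets the second. *)
Lemma simple_path_unique (G : sgraph) (x : G) (p q : seq G) :
  is_tree G ->
  path (@edge G) x p -> uniq (x :: p) -> path (@edge G) x q -> uniq (x :: q) ->
  last x p = last x q -> p = q.
Proof.
move=> [_ acyclic].
have last_in (y a : G) s : last y (a :: s) \in a :: s by exact: (mem_last a s).
elim: p x q => [|a p IHp] x [|b q] //.
- by move=> _ _ _ /andP[/negP xq _] xE; case: xq; rewrite {1}[x]xE last_in.
- by move=> _ /andP[/negP xp _] _ _ xE; case: xp; rewrite -{1}[x]xE last_in.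
move=> xap Uxap xbq Uxbq lastE.
have [eq_ab|neq_ab] := eqVneq a b.
  move: xbq Uxbq lastE; rewrite -eq_ab => xbq Uxbq lastE.
  congr cons; apply: (IHp a) => //.
  - by case/andP: xap.
  - by case/andP: Uxap.
  - by case/andP: xbq.
  - by case/andP: Uxbq.
have hit : has (mem (b :: q)) (a :: p).
  apply/hasP; exists (last x (a :: p)); first exact: last_in.
  by rewrite lastE; exact: last_in.
have [w [p1 [p2 [pE w_q p1_q]]]] : exists w p1 p2,
    [/\ a :: p = p1 ++ w :: p2, w \in b :: q & ~~ has (mem (b :: q)) p1].
  by case: (split_find hit) => w p1 p2 ? ?; exists w, p1, p2; rewrite cat_rcons.
have [q1 [q2 qE]] : exists q1 q2, b :: q = q1 ++ w :: q2.
  by case/splitPr: w_q => q1 q2; exists q1, q2.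
(* If the meeting point were the first vertex of both paths, the paths would
   start with the same step; otherwise the cycle has at least 3 vertices. *)
case: (acyclic (x :: p1 ++ w :: rev q1)).
  rewrite /= size_cat /= size_rev.
  case: {p1_q}p1 pE => [|? ?] pE; case: q1 qE => [|? ?] qE; rewrite ?addnS //.
  by case: pE qE neq_ab => -> _ [-> _]; rewrite eqxx.
move: xap Uxap xbq Uxbq p1_q; rewrite pE qE.
rewrite !cat_path /= => /and3P[xp1 p1w _] Up /and3P[xq1 q1w _] Uq p1_q.
apply/andP; split.
  rewrite /= rcons_path cat_path /= xp1 p1w /= last_cat /=.
  have := rev_path (@edge G) x (rcons q1 w).
  rewrite last_rcons belast_rcons rev_cons rcons_path => ->.
  rewrite (eq_path (e' := @edge G)) ?rcons_path ?xq1 //.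
  by move=> u v; rewrite edge_sym.
move: Up; rewrite mem_cat cat_uniq !negb_or => /and4P[/andP[xp1' xwp2] Up1 _ _].
move: xwp2 => /andP[xw _].
move: Uq; rewrite /= mem_cat cat_uniq !negb_or.
move=> /and4P[/and3P[xq1' _ _] Uq1 /andP[wq1 _] _].
move: p1_q; rewrite has_sym /= has_cat /= !negb_or => /and3P[q1p1 wp1 _].
rewrite /= mem_cat in_cons mem_rev !negb_or xp1' xw xq1' /=.
rewrite cat_uniq Up1 /= negb_or wp1 mem_rev wq1 rev_uniq Uq1 /= andbT.
by rewrite (eq_has_r (mem_rev q1)).
Qed.

Section RootPaths.
Variable T : rooted_tree.
Implicit Types (s t u v : T) (D : {set T}).

Definition is_root_path s (p : seq T) : Prop :=
  [/\ path (@edge T) s p, uniq (s :: p) & last s p = Defs.root T].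

Lemma root_path_exists s : exists p, is_root_path s p.
Proof.
have [conn _] := treeP T.
have /connectP[p sp pE] := conn s (Defs.root T).
by case: (shortenP sp) pE => q sq Uq _ qE; exists q.
Qed.

Lemma root_pathE s p : is_root_path s p ->
  forall v, (v \in root_path s) = (v \in s :: p).
Proof.
move=> [sp Up pE] v; rewrite finset.in_set.
apply/asboolP/idP => [[q [sq Uq qE vq]]|vp].
  by rewrite (simple_path_unique (treeP T) sp Up sq Uq) // pE.
by exists p.
Qed.

Lemma is_root_path_suffix s p p1 v p2 :
  is_root_path s p -> s :: p = p1 ++ v :: p2 -> is_root_path v p2.
Proof.
move=> [sp Up lastE] pE; case: p1 pE => [[<- <-] //|_ p1 /= [_ pE]].
move: sp Up lastE; rewrite pE /= cat_path cat_uniq last_cat /=.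
by move=> /and3P[_ _ v_p2] /and4P[_ _ _ Uvp2]; split.
Qed.

Lemma root_path_split s p v : is_root_path s p -> v \in root_path s ->
  exists p1 p2, s :: p = p1 ++ v :: p2 /\ is_root_path v p2.
Proof.
move=> sp; rewrite (root_pathE sp) => vp.
have [p1 [p2 pE]] : exists p1 p2, s :: p = p1 ++ v :: p2.
  by case/splitPr: vp => p1 p2; exists p1, p2.
by exists p1, p2; split=> //; exact: is_root_path_suffix pE.
Qed.

Lemma root_path_refl s : s \in root_path s.
Proof.
by have [p sp] := root_path_exists s; rewrite (root_pathE sp) mem_head.
Qed.

Lemma root_path_sub s v : v \in root_path s -> root_path v \subset root_path s.
Proof.
have [p sp] := root_path_exists s => /(root_path_split sp)[p1 [p2 [pE vp2]]].
apply/fintype.subsetP => u.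
by rewrite (root_pathE vp2) (root_pathE sp) pE mem_cat => ->; rewrite orbT.
Qed.

Lemma root_path_leE v s : tree_le v s = (v \in root_path s).
Proof.
apply/idP/idP => [/fintype.subsetP|]; last exact: root_path_sub.
by apply; exact: root_path_refl.
Qed.

Lemma root_path_total s u v : u \in root_path s -> v \in root_path s ->
  (u \in root_path v) || (v \in root_path u).
Proof.
have [p sp] := root_path_exists s.
move=> /(root_path_split sp)[p1 [p2 [pE up2]]].
rewrite (root_pathE sp) pE mem_cat -(root_pathE up2) orbC.
case/orP=> [->|vp1]; first by rewrite orbT.
have [q1 [q2 p1E]] : exists q1 q2, p1 = q1 ++ v :: q2.
  by case/splitPr: vp1 => q1 q2; exists q1, q2.
have vq2 : is_root_path v (q2 ++ u :: p2).
  by apply: (is_root_path_suffix sp (p1 := q1)); rewrite pE p1E -catA.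
by rewrite (root_pathE vq2) in_cons mem_cat mem_head !orbT.
Qed.

Lemma root_path_anti u v : u \in root_path v -> v \in root_path u -> u = v.
Proof.
have [p vp] := root_path_exists v => uv vu.
have [p1 [p2 [pE up2]]] := root_path_split vp uv.
have [q1 [q2 [qE [vq Uq lq]]]] := root_path_split up2 vu.
have [vp' Up lp] := vp.
have pq := simple_path_unique (treeP T) vp' Up vq Uq (etrans lp (esym lq)).
have : size p1 = 0%N.
  by move: (congr1 size pE) (congr1 size qE); rewrite pq !size_cat /=; lia.
by move/size0nil => p1_nil; move: pE; rewrite p1_nil => -[].
Qed.

(** The vertex [t] is the neighbour of [s] on its path to the root. *)
Lemma root_path_pred s :
  root_path s :\ s = finset.set0 \/ exists t, root_path s :\ s = root_path t.
Proof.
have [[|t p] sp] := root_path_exists s.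
  left; apply/setP => v; rewrite in_setD1 (root_pathE sp).
  by rewrite in_cons in_nil finset.in_set0 orbF andNb.
right; exists t; have tp := is_root_path_suffix sp (p1 := [:: s]) erefl.
apply/setP => v.
rewrite in_setD1 (root_pathE sp) (root_pathE tp) [in LHS]in_cons.
have [_ /andP[st _] _] := sp; case: eqP => //= ->.
by rewrite (negbTE st).
Qed.

Definition down_closed D : Prop :=
  forall u v, u \in D -> v \in root_path u -> v \in D.

(** Attaching vertices one at a time, each after the vertices below it.  A
vertex of [D] whose path to the root is longest can be removed from [D]. *)
Lemma down_closed_ind (P : {set T} -> Prop) :
  P finset.set0 ->
  (forall s D, down_closed D -> s \notin D -> root_path s :\ s \subset D ->
     P D -> P (s |: D)) ->
  P [set: T]%SET.
Proof.
move=> P0 PS.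
suff: forall n D, #|D| = n -> down_closed D -> P D.
  by move=> /(_ _ [set: T]%SET erefl); apply=> u v _ _; rewrite finset.in_setT.
elim=> [|n IHn] D Dn dD; first by move/cards0_eq: Dn => ->.
have [s0 s0D] : exists s0, s0 \in D by apply/card_gt0P; rewrite Dn.
have [s sD s_max] := arg_maxnP (fun s => #|root_path s|) s0D.
have dDs : down_closed (D :\ s).
  move=> u v /setD1P[us uD] vu; rewrite in_setD1 (dD u) // andbT.
  apply: contra us => /eqP vs; rewrite vs in vu.
  have eq_us : root_path s = root_path u.
    by apply/eqP; rewrite eqEcard root_path_sub //; exact: s_max.
  apply/eqP/root_path_anti => //; rewrite eq_us; exact: root_path_refl.
rewrite -(finset.setD1K sD); apply: PS => //; first by rewrite in_setD1 eqxx.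
  by apply: finset.setSD; apply/fintype.subsetP => v; exact: dD.
by apply: IHn => //; move: Dn; rewrite (cardsD1 s) [s \in D]sD => -[].
Qed.

End RootPaths.

(** * Loops and homotopies in coordinates *)

Section Coordinates.
Variables (R : realType) (G : sgraph).
Local Notation I := (unit_interval R).
Local Notation C := (R[i]^o).
Local Notation X := (config_space R G).

Lemma config_coord_continuous (Z : topologicalType) (F : Z -> X) (v : G) :
  continuous F -> continuous (fun z => set_val (F z) v : C).
Proof.
move=> F_cts; apply: (comp_continuous (f := fun z => set_val (F z))
  (g := fun f : {ptws G -> R[i]^o} => f v)); last exact: proj_continuous.
apply: (comp_continuous (g := set_val) F_cts); exact: initial_continuous.
Qed.

Lemma coord_neq (x : X) (u v : G) : edge u v -> set_val x u != set_val x v.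
Proof. by move=> uv; apply/eqP; exact: (set_valP x). Qed.

Lemma config_map_exists (Z : topologicalType) (f : G -> Z -> C) :
  (forall v, continuous (f v)) ->
  (forall u v, edge u v -> forall z, f u z != f v z) ->
  exists2 F : Z -> X, continuous F & forall z v, set_val (F z) v = f v z.
Proof.
move=> f_cts f_neq.
have f_in z : (f^~ z : {ptws G -> R[i]^o}) \in X.
  by rewrite inE => u v uv; apply/eqP/f_neq.
exists (fun z => exist (fun x => x \in X) _ (f_in z)) => //.
by apply: continuous_comp_initial; apply: ptws_continuous.
Qed.

Variables (b : G -> R[i]) (b_inj : injective b).
Local Notation x0 := (base_point (G := G) b_inj).
Local Notation loop := {path I from x0 to x0 in X}.

Lemma loop_exists (f : G -> I -> C) :
  (forall v, continuous (f v)) ->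
  (forall u v, edge u v -> forall t, f u t != f v t) ->
  (forall v, f v zero = b v /\ f v one = b v) ->
  exists p : loop, forall t v, set_val (p t) v = f v t.
Proof.
move=> f_cts f_neq f_end; have [F F_cts FE] := config_map_exists f_cts f_neq.
have F0 : F zero = x0.
  apply: val_inj; apply: funext => v; exact: etrans (FE _ _) (f_end v).1.
have F1 : F one = x0.
  apply: val_inj; apply: funext => v; exact: etrans (FE _ _) (f_end v).2.
by exists (mk_path F_cts F0 F1).
Qed.

Lemma homotopic_coordsP (p q : loop) :
  homotopic p q <->
  exists K : G -> I * I -> C,
    [/\ forall v, continuous (K v),
        forall u v, edge u v -> forall z, K u z != K v z,
        forall v t, K v (t, zero) = set_val (p t) v,
        forall v t, K v (t, one) = set_val (q t) v &
        forall v t, K v (zero, t) = b v /\ K v (one, t) = b v].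
Proof.
split=> [[H [H_cts H0 H1 H_end]]|[K [K_cts K_neq K0 K1 K_end]]].
  exists (fun v z => set_val (H z) v); split=> [v|u v uv z|v t|v t|v t].
  - exact: config_coord_continuous.
  - exact: coord_neq.
  - by rewrite H0.
  - by rewrite H1.
  - by rewrite (H_end t).1 (H_end t).2.
have [F F_cts FE] := config_map_exists K_cts K_neq.
exists F; split=> // [t|t|t].
- apply: val_inj; apply: funext => v; exact: etrans (FE _ _) (K0 _ _).
- apply: val_inj; apply: funext => v; exact: etrans (FE _ _) (K1 _ _).
- split; apply: val_inj; apply: funext => v.
    exact: etrans (FE _ _) (K_end v t).1.
  exact: etrans (FE _ _) (K_end v t).2.
Qed.

Lemma loop_coord_end (p : loop) v :
  set_val (p zero) v = b v /\ set_val (p one) v = b v.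
Proof. by rewrite path_zero path_one. Qed.

Lemma loop_coord_continuous (p : loop) v :
  continuous (fun t => set_val (p t) v : C).
Proof. by apply: config_coord_continuous; exact: cts_fun. Qed.

End Coordinates.

(** * Families of braids along the root paths *)

Section TreeBraids.
Variables (R : realType) (T : rooted_tree) (b : T -> R[i]).
Hypothesis b_inj : injective b.
Local Notation I := (unit_interval R).
Local Notation C := (R[i]^o).
Local Notation XT := (config_space R (comparability_graph T)).
Local Notation strand s := {v | v \in root_path s}.
Local Notation XP s := (config_space R (complete_graph (strand s))).
Local Notation bT := (base_point (G := comparability_graph T) b_inj).
Local Notation bP s := (base_on b_inj (root_path s)).
Local Notation loopT := {path I from bT to bT in XT}.
Local Notation loopP s := {path I from bP s to bP s in XP s}.
Implicit Types (s : T) (D : {set T}).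

Lemma root_path_comparable s (u v : T) :
  u \in root_path s -> v \in root_path s -> u != v -> tree_comparable u v.
Proof.
move=> us vs uv; rewrite /tree_comparable uv !root_path_leE.
exact: root_path_total us vs.
Qed.

Section Restriction.
Variable s : T.

Fact tree_restrict_in (x : XT) :
  (fun v : strand s => set_val x (val v)) \in XP s.
Proof.
rewrite inE => u v /= uv; apply: (set_valP x) => /=.
by apply: root_path_comparable (valP u) (valP v) _; rewrite (inj_eq val_inj).
Qed.

Definition tree_restrict (x : XT) : XP s :=
  exist (fun y => y \in XP s) _ (tree_restrict_in x).

Lemma tree_restrict_continuous : continuous tree_restrict.
Proof.
apply: continuous_comp_initial; apply: ptws_continuous => v.
have id_cts : continuous (@id XT) by move=> x; exact: cvg_id.
exact: (@config_coord_continuous R (comparability_graph T) _ id (val v) id_cts).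
Qed.

Lemma tree_restrict_base : tree_restrict bT = bP s.
Proof. exact: val_inj. Qed.

Definition tree_restrict_pi1 : Gamma_tree b_inj -> tree_braid b_inj s :=
  pi1_map tree_restrict_continuous tree_restrict_base.

Definition tree_restrict_loop (p : loopT) : loopP s :=
  push tree_restrict_continuous tree_restrict_base p.

End Restriction.

Lemma tree_restrict_rho s' s (le : tree_le s' s) a :
  rho b_inj le (tree_restrict_pi1 s a) = tree_restrict_pi1 s' a.
Proof.
rewrite -(pi1_repr a) /tree_restrict_pi1 /rho /braid_proj /=.
rewrite !pi1_mapE; apply/pi1_classP/homotopic_ext => t.
exact: val_inj.
Qed.

Fact tree_restrict_compatible a :
  (fun s => tree_restrict_pi1 s a : tree_braid b_inj s)
    \in compatible (b_inj := b_inj).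
Proof. by apply/asboolP => s' s le; exact: tree_restrict_rho. Qed.

Definition tree_restriction (a : Gamma_tree b_inj) : tree_lim b_inj :=
  exist (fun g => g \in compatible (b_inj := b_inj)) _
    (tree_restrict_compatible a).

Lemma tree_restrictionM : {morph tree_restriction : a a' / (a * a')%g}.
Proof.
move=> a a'; apply: val_inj; apply: functional_extensionality_dep => s.
exact: pi1_mapM.
Qed.

Lemma tree_restriction1 : tree_restriction 1%g = 1%g.
Proof.
apply: val_inj; apply: functional_extensionality_dep => s.
exact: pi1_map1.
Qed.

HB.instance Definition _ := isUMagmaMorphism.Build
  (Gamma_tree b_inj) (tree_lim b_inj) tree_restriction
  (tree_restriction1, tree_restrictionM).

(** This is what makes the configuration space of the tree an iterated fibre
product: a new strand is constrained only by those below it. *)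
Lemma comparable_below D s v : down_closed D -> s \notin D -> v \in D ->
  tree_comparable s v -> v \in root_path s :\ s.
Proof.
move=> dD sD vD /andP[sv]; rewrite !root_path_leE => /orP[sv'|vs].
  by rewrite (dD _ _ vD sv') in sD.
by rewrite in_setD1 eq_sym sv vs.
Qed.

(** The null homotopies given over the various paths to the root do not agree
with one another; they are replaced one strand at a time by compatible ones. *)
Lemma homotopic_to_constant (p : loopT) :
  (forall s, homotopic (tree_restrict_loop s p) (constant_path R (bP s))) ->
  homotopic p (constant_path R bT).
Proof.
move=> p_null.
(* D is the set of vertices whose strands have been contracted. *)
pose null D (H : T -> I * I -> C) :=
  [/\ forall v, v \in D -> continuous (H v),
      forall u v, u \in D -> v \in D -> tree_comparable u v ->
        forall z, H u z != H v z,
      forall v t, v \in D -> H v (t, zero) = set_val (p t) v &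
      forall v t, v \in D ->
        [/\ H v (zero, t) = b v, H v (one, t) = b v & H v (t, one) = b v]].
suff [H [H_cts H_neq H0 H_bd]] : exists H, null [set: T]%SET H.
  apply/homotopic_coordsP; exists H.
  split=> [v|u v uv z|v t|v t|v t]; have inT := finset.in_setT.
  - exact: H_cts.
  - exact: H_neq.
  - exact: H0.
  - by have [] := H_bd v t (inT _ v).
  - by have [] := H_bd v t (inT _ v).
apply: (down_closed_ind (P := fun D => exists H, null D H))
  => [|s D dD sD AD [H [H_cts H_neq H0 H_bd]]].
  exists (fun v _ => 0).
  by split=> [v|u v|v t|v t]; rewrite finset.in_set0.
have [K [K_cts K_neq K0 K1 K_end]] := (homotopic_coordsP _ _).1 (p_null s).
pose A := {v | v \in root_path s :\ s}.
have valD (j : A) : val j \in D by exact: fintype.subsetP AD _ (valP j).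
have incl_in (j : A) : val j \in root_path s.
  by have /setD1P[] := valP j.
pose incl (j : A) : strand s := exist _ (val j) (incl_in j).
pose self : strand s := exist _ s (root_path_refl s).
have self_incl j : @edge (complete_graph (strand s)) (incl j) self.
  by have /setD1P[js _] := valP j; rewrite /= -(inj_eq val_inj).
have A_comp (i j : A) : i != j -> tree_comparable (val i) (val j).
  move=> ij; apply: (root_path_comparable (incl_in i) (incl_in j)).
  by rewrite (inj_eq val_inj).
have [g [g_cts H_g g0 g_bd]] : exists g : I * I -> C,
    [/\ continuous g, forall j : A, forall z, H (val j) z != g z,
        forall u, g (u, zero) = K self (u, zero) &
        forall t, [/\ g (zero, t) = b s, g (one, t) = b s & g (t, one) = b s]].
  apply: (null_homotopy_transfer (h := fun j : A => H (val j))
    (k := fun j : A => K (incl j)) (b := fun j : A => b (val j))).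
  - by move=> j; exact: H_cts.
  - by move=> j; exact: K_cts.
  - exact: K_cts.
  - by move=> i j ij z; apply: H_neq => //; exact: A_comp.
  - move=> i j ij z; apply: K_neq => /=.
    by apply: contra_neq ij => /(congr1 val)/= ?; exact: val_inj.
  - by move=> j z; exact: K_neq.
  - by move=> j u; rewrite H0 // K0.
  - by move=> j t; exact: H_bd.
  - by move=> j t; split; rewrite ?K1 ?(K_end _ _).1 ?(K_end _ _).2.
  - by move=> t; split; rewrite ?K1 ?(K_end _ _).1 ?(K_end _ _).2.
have g_neq v z : v \in D -> tree_comparable s v -> H v z != g z.
  by move=> vD sv; exact: (H_g (exist _ v (comparable_below dD sD vD sv)) z).
exists (fun v => if v == s then g else H v); split=> [v|u v|v t|v t].
- by rewrite in_setU1; case: eqP => [_ _|_]; [exact: g_cts|exact: H_cts].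
- rewrite !in_setU1; case: eqP => [->|_] /=; case: eqP => [->|_] //= uD vD uv z.
  + by rewrite /tree_comparable eqxx in uv.
  + by rewrite eq_sym g_neq.
  + by rewrite g_neq // tree_comparable_sym.
  + exact: H_neq.
- by rewrite in_setU1; case: eqP => [->|_] /= vD; [rewrite g0 K0|exact: H0].
- by rewrite in_setU1; case: eqP => [->|_] /= vD; [exact: g_bd|exact: H_bd].
Qed.

Section Assembly.
Variable q : forall s, loopP s.
Hypothesis q_compat : forall s' s (le : tree_le s' s),
  homotopic
    (push (@restrict_continuous R T _ _ le) (restrict_base le b_inj) (q s))
    (q s').

(** With [A] the set of vertices strictly below [s]: the lower strands of [q s]
deform into those of [x].  They are either absent or the strands of a path to
the root, where compatibility applies. *)
Lemma lower_strands_homotopy (x : T -> I -> C) s (A : {set T})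
    (sub : A \subset root_path s) :
  A = finset.set0 \/ (exists t, A = root_path t) ->
  (forall t, A = root_path t -> exists y : loopP t,
     (forall u v, set_val (y u) v = x (val v) u) /\ homotopic (q t) y) ->
  exists K : {v | v \in A} -> I * I -> C,
    [/\ forall v, continuous (K v),
        forall u v, u != v -> forall z, K u z != K v z,
        forall v t, K v (t, zero) = set_val (q s t) (sub_incl sub v),
        forall v t, K v (t, one) = x (val v) t &
        forall v t, K v (zero, t) = b (val v) /\ K v (one, t) = b (val v)].
Proof.
move=> [A0|[t At]] x_q.
  have emptyA v : v \in A -> False by rewrite A0 finset.in_set0.
  by exists (fun v _ => 0); split=> -[v vA]; case: (emptyA v vA).
subst A.
have [//|y [yE y_q]] := x_q t.
have := homotopic_trans (q_compat sub) y_q.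
move=> /homotopic_coordsP[K [K_cts K_neq K0 K1 K_end]].
by exists K; split=> // v u; rewrite K1 yE.
Qed.

(** Each strand of the assembled loop is the end of a lift of a homotopy; the
lift itself is what shows that the loop restricts to [q s] up to homotopy. *)
Lemma assembled_loop_exists :
  exists p : loopT, forall s, homotopic (q s) (tree_restrict_loop s p).
Proof.
(* The last clause quantifies over y because the restriction of x to the path
   of s is a loop of configurations only by virtue of the other clauses. *)
pose glued D (x : T -> I -> C) :=
  [/\ forall v, v \in D -> continuous (x v),
      forall u v, u \in D -> v \in D -> tree_comparable u v ->
        forall t, x u t != x v t,
      forall v, v \in D -> x v zero = b v /\ x v one = b v &
      forall s (y : loopP s), s \in D ->
        (forall t v, set_val (y t) v = x (val v) t) -> homotopic (q s) y].
suff [x [x_cts x_neq x_end x_q]] : exists x, glued [set: T]%SET x.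
  have inT v : v \in [set: T]%SET by exact: finset.in_setT.
  have [p pE] : exists p : loopT, forall t v, set_val (p t) v = x v t.
    apply: loop_exists => [v|u v uv|v]; [exact: x_cts| |exact: x_end].
    exact: x_neq.
  exists p => s; apply: x_q => // t v.
  by rewrite -pE.
apply: (down_closed_ind (P := fun D => exists x, glued D x))
  => [|s D dD sD AD [x [x_cts x_neq x_end x_q]]].
  exists (fun v _ => 0).
  by split=> [v|u v|v|v y]; rewrite finset.in_set0.
have sub : root_path s :\ s \subset root_path s by exact: subD1set.
have [||K [K_cts K_neq K0 K1 K_end]] := lower_strands_homotopy (x := x) sub.
- exact: root_path_pred.
- move=> t tE.
  have path_D v : v \in root_path t -> v \in D.
    by rewrite -tE; exact: (fintype.subsetP AD).
  have tD : t \in D by apply: path_D; exact: root_path_refl.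
  have [y yE] : exists y : loopP t, forall u v, set_val (y u) v = x (val v) u.
    apply: (@loop_exists R (complete_graph (strand t)) _
      (@inj_on R T b b_inj (root_path t)) (fun v => x (val v))).
    + by move=> v; apply: x_cts; exact: path_D (valP v).
    + move=> u v uv; apply: x_neq; try exact: path_D (valP _).
      apply: (root_path_comparable (valP u) (valP v)).
      by rewrite (inj_eq val_inj).
    + by move=> v; apply: x_end; exact: path_D (valP v).
  by exists y; split=> //; exact: x_q.
pose self : strand s := exist _ s (root_path_refl s).
have self_incl j : @edge (complete_graph (strand s)) (sub_incl sub j) self.
  by have /setD1P[js _] := valP j; rewrite /= -(inj_eq val_inj).
have [f [f_cts f0 K_f f_cst]] : exists f : I * I -> C,
    [/\ continuous f, forall u, f (u, zero) = set_val (q s u) self,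
        forall j z, K j z != f z &
        forall u, (forall j t, K j (u, t) = K j (u, zero)) ->
          forall t, f (u, t) = set_val (q s u) self].
  apply: lift_point => //.
  - exact: (@square_compact R).
  - exact: loop_coord_continuous.
  - by move=> j u; rewrite K0; exact: coord_neq.
have f_end t : f (zero, t) = b s /\ f (one, t) = b s.
  have [q0 q1] := loop_coord_end (q s) self; split.
    rewrite f_cst; first by rewrite q0.
    by move=> j u; rewrite !(K_end _ _).1.
  rewrite f_cst; first by rewrite q1.
  by move=> j u; rewrite !(K_end _ _).2.
have below v : v \in D -> tree_comparable s v -> v \in root_path s :\ s.
  exact: comparable_below.
have f_neq v t : v \in D -> tree_comparable s v -> x v t != f (t, one).
  by move=> vD sv; have := K_f (exist _ v (below v vD sv)) (t, one); rewrite K1.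
exists (fun v => if v == s then fun t => f (t, one) else x v).
split=> [v|u v|v|t y].
- rewrite in_setU1; case: eqP => [_ _|_]; last exact: x_cts.
  apply: (comp_continuous (f := fun t => (t, one))) f_cts.
  apply: (pair_continuous (f := id)); last exact: cst_continuous.
  by move=> z; exact: cvg_id.
- rewrite !in_setU1; case: eqP => [->|_] /=; case: eqP => [->|_] //= uD vD uv z.
  + by rewrite /tree_comparable eqxx in uv.
  + by rewrite eq_sym f_neq.
  + by rewrite f_neq // tree_comparable_sym.
  + exact: x_neq.
- rewrite in_setU1; case: eqP => [-> _|_] /=; last exact: x_end.
  exact: f_end.
rewrite in_setU1; case: eqP => [ts|_] /= tD yE; last first.
  apply: x_q => // u v; rewrite yE; case: eqP => // vs; case/negP: sD.
  by rewrite -[s]vs; exact: dD tD (valP v).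
subst t => {tD}.
have strandP (w : strand s) : w = self \/ exists j, w = sub_incl sub j.
  have [ws|ws] := eqVneq (val w) s; [left; exact: val_inj|right].
  have wA : val w \in root_path s :\ s by rewrite in_setD1 ws (valP w).
  by exists (exist _ (val w) wA); exact: val_inj.
have [L L_self L_incl] : exists2 L : strand s -> I * I -> C,
    L self = f & forall j, L (sub_incl sub j) = K j.
  exists (fun w => if insub (val w) is Some j then K j else f) => [|j].
    by rewrite insubF //= in_setD1 eqxx.
  by rewrite (valK j : insub (val (sub_incl sub j)) = Some j).
apply/(homotopic_coordsP (q s) y); exists L.
split=> [w|u w|w t|w t|w t].
- case: (strandP w) => [->|[j ->]]; rewrite ?L_self ?L_incl; first exact: f_cts.
  exact: K_cts.
- case: (strandP u) => [->|[i ->]]; case: (strandP w) => [->|[j ->]];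
    rewrite ?L_self ?L_incl => uw z.
  + by rewrite /= eqxx in uw.
  + by rewrite eq_sym K_f.
  + exact: K_f.
  + by apply: K_neq; apply: contra_neq uw => ->.
- case: (strandP w) => [->|[j ->]]; rewrite ?L_self ?L_incl; first exact: f0.
  exact: K0.
- case: (strandP w) => [->|[j ->]]; rewrite ?L_self ?L_incl yE /= ?eqxx //.
  by have /setD1P[/negbTE -> _] := valP j.
- case: (strandP w) => [->|[j ->]]; rewrite ?L_self ?L_incl; first exact: f_end.
  exact: K_end.
Qed.

End Assembly.

End TreeBraids.

Theorem theorem2 (R : realType) (T : rooted_tree) (b : T -> R[i])
    (b_inj : injective b) :
  exists phi : {multiplicative Gamma_tree b_inj -> tree_lim b_inj},
    bijective phi.
Proof.
pose phi : {multiplicative Gamma_tree b_inj -> tree_lim b_inj} :=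
  @tree_restriction R T b b_inj.
exists phi.
have phi_inj : injective phi.
  apply: (@gmulf_inj _ _ (@tree_restriction R T b b_inj)) => a.
  rewrite -(pi1_repr a) => phi1.
  apply/pi1_classP/homotopic_to_constant => s.
  apply/pi1_classP; rewrite -pi1_mapE.
  exact: (congr1 (fun g => val g s) phi1).
have phi_surj g : exists a, phi a = g.
  have /asboolP g_compat := valP g.
  have [s' s le|p pE] := @assembled_loop_exists R T b b_inj
    (fun s => repr (val g s)).
    apply/pi1_classP; rewrite -pi1_mapE !pi1_repr; exact: g_compat.
  exists (pi1_class p); apply: val_inj.
  apply: functional_extensionality_dep => s.
  rewrite /= /tree_restrict_pi1 pi1_mapE -[RHS]pi1_repr.
  by apply/pi1_classP; apply: homotopic_sym; exact: pE.
have [psi psiK] := choice phi_surj.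
exists psi => // a; exact/phi_inj/psiK.
Qed.
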